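(* Fix $m>1$. There is a function $a:(0,\infty)\to(0,1)$, depending continuously on $\beta$, such that for every $\beta>0$ every minimiser $\rho_\beta\in\mathcal P(\Omega)$ of $\mathcal F_\beta^m$ is Hölder continuous with exponent $a(\beta)$. Moreover, let $I\subset(0,\infty)$ be a bounded interval and let $\{\rho_\beta\}_{\beta\in I}$ be a family such that $\rho_\beta$ is a minimiser of $\mathcal F_\beta^m$ for each $\beta\in I$. Then the family $\{\rho_\beta\}_{\beta\in I}$ is relatively compact in $C^0(\Omega)$.
   Context: $\Omega=\mathbb T^d$ is the torus of side length $L>0$; $\mathcal P(\Omega)$ is the set of Borel probability measures on $\Omega$, identified with their densities when these exist. $W\in C^2(\Omega)$ is even along every coordinate and has mean zero. For $m>1$, $$\mathcal F_\beta^m(\rho)=\frac{\beta^{-1}}{m-1}\int_\Omega\rho^m\,dx-\frac{\beta^{-1}}{m-1}+\frac12\iint_{\Omega\times\Omega}W(x-y)\rho(x)\rho(y)\,dx\,dy$$ whenever these quantities are finite, and $+\infty$ otherwise. *)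

(* Defs.v *)
From HB Require Import structures.
From mathcomp Require Import all_boot all_order all_algebra archimedean.
From mathcomp Require Import generic_quotient ring_quotient.
From mathcomp Require Import all_classical all_reals all_analysis.

Set Implicit Arguments.
Unset Strict Implicit.
Unset Printing Implicit Defensive.

Import Order.TTheory GRing.Theory Num.Theory.
Import numFieldNormedType.Exports.

Local Open Scope classical_set_scope.
Local Open Scope ring_scope.
Local Open Scope quotient_scope.

(* L Z^d, for L <> 0 *)
Definition lattice (R : realType) (d : nat) (L : R) : {pred 'rV[R]_d} :=
  [pred v : 'rV[R]_d | [forall i, v 0 i / L \is a Num.int]].
Arguments lattice {R} d L.

Lemma lattice_zmod_closed (R : realType) d (L : R) : zmod_closed (lattice d L).
Proof.
split=> [|u v /forallP hu /forallP hv]; apply/forallP => i.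
  by rewrite mxE mul0r rpred0.
by rewrite !mxE mulrBl rpredB.
Qed.

HB.instance Definition _ (R : realType) d (L : R) :=
  GRing.isZmodClosed.Build 'rV[R]_d (lattice d L) (lattice_zmod_closed d L).

Definition torus (R : realType) (d : nat) (L : R) : Type :=
  quotient_topology (Quotient.quot (lattice d L)).

HB.instance Definition _ (R : realType) d (L : R) :=
  PointedTopological.on (torus d L).
HB.instance Definition _ (R : realType) d (L : R) :=
  Quotient.on (torus d L).
HB.instance Definition _ (R : realType) d (L : R) :=
  GRing.Zmodule.copy (torus d L) (Quotient.quot (lattice d L)).
HB.instance Definition _ (R : realType) d (L : R) :=
  Measurable.copy (torus d L) (g_sigma_algebraType (@open (torus d L))).

(* the quotient metric; the library's norm on 'rV[R]_d is the sup norm, and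
   passing to the Euclidean one would only change the constant in [holder] *)
Definition torus_dist (R : realType) d (L : R) (p q : torus d L) : R :=
  inf [set `|v| | v in [set v : 'rV[R]_d | \pi_(torus d L) v = p - q]].

Definition holder (R : realType) d (L : R) (a : R)
    (u : torus d L -> R) : Prop :=
  exists C : R, forall p q, `|u p - u q| <= C * torus_dist p q `^ a.

(* Functions on the torus are differentiated through their periodic lifts. *)
Fixpoint Ck (R : realType) d (k : nat) (f : 'rV[R]_d -> R) : Prop :=
  continuous f /\
  if k is k'.+1 then
    forall i : 'I_d, (forall x, derivable f x (delta_mx 0 i)) /\
                     Ck k' ('D_(delta_mx 0 i) f)
  else True.

Definition torus_Ck (R : realType) d (L : R) (k : nat)
    (f : torus d L -> R) : Prop :=
  Ck k (fun x => f (\pi_(torus d L) x)).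

Definition reflect_coord (R : realType) d (i : 'I_d)
    (x : 'rV[R]_d) : 'rV[R]_d :=
  \row_j (if j == i then - x 0 j else x 0 j).

Definition coord_even (R : realType) d (L : R)
    (f : torus d L -> R) : Prop :=
  forall (i : 'I_d) (x : 'rV[R]_d),
    f (\pi_(torus d L) (reflect_coord i x)) = f (\pi_(torus d L) x).

Local Open Scope ereal_scope.

(* n-dimensional Lebesgue measure, as an iterated product *)
Fixpoint lebesgue_tuple (R : realType) (n : nat) :
    set (n.-tuple (measurableTypeR R)) -> \bar R :=
  match n with
  | 0 => dirac [tuple]
  | k.+1 => pushforward (lebesgue_measure \x @lebesgue_tuple R k)
              (fun p => [tuple of p.1 :: p.2])
  end.
Arguments lebesgue_tuple {R} n A.

(* Lebesgue measure dx on the torus, of total mass L^d, carried over from the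
   fundamental domain [0, L)^d *)
Definition volume (R : realType) d (L : R) (A : set (torus d L)) : \bar R :=
  lebesgue_tuple d [set t : d.-tuple (measurableTypeR R) |
    (forall i, (0 <= tnth t i < L)%R) /\
    A (\pi_(torus d L) (\row_i tnth t i))].
Arguments volume {R} d L A.

Definition is_density (R : realType) d (L : R)
    (rho : probability (torus d L) R) (f : torus d L -> R) : Prop :=
  [/\ measurable_fun setT f, (forall x, (0 <= f x)%R) &
      forall A, measurable A -> rho A = \int[volume d L]_(x in A) (f x)%:E].

(* unique up to null sets, and only meaningful when a density exists *)
Definition density (R : realType) d (L : R)
    (rho : probability (torus d L) R) : torus d L -> R :=
  xget (cst 0%R) (is_density rho).

Definition free_energy (R : realType) d (L : R)
    (W : torus d L -> R) (m beta : R) (rho : probability (torus d L) R) : \bar R :=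
  let f := density rho in
  let S := \int[volume d L]_x (f x `^ m)%:E in
  let J := \int[volume d L \x volume d L]_z
             (W (z.1 - z.2) * f z.1 * f z.2)%:E in
  if `[< [/\ is_density rho f, S \is a fin_num & J \is a fin_num] >]
  then (beta^-1 / (m - 1))%:E * S - (beta^-1 / (m - 1))%:E + (2^-1)%:E * J
  else +oo.

Definition is_minimiser (R : realType) T (F : T -> \bar R) (x : T) : Prop :=
  forall y, F x <= F y.

(* C^0 of the torus with the topology of uniform convergence *)
Definition C0 (R : realType) d (L : R) : set {uniform torus d L -> R} :=
  [set f | continuous (f : torus d L -> R)].
Arguments C0 {R} d L.

(* Main.v *)
Require Import Defs.
From HB Require Import structures.
From mathcomp Require Import all_boot all_order all_algebra.
From mathcomp Require Import all_classical all_reals all_analysis.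
From mathcomp Require Import measurable_realfun generic_quotient ring_quotient lra ring.
Import Order.TTheory GRing.Theory Num.Theory.
Import numFieldNormedType.Exports.
Set Implicit Arguments.
Unset Strict Implicit.
Unset Printing Implicit Defensive.
Local Open Scope classical_set_scope.
Local Open Scope ring_scope.
Local Open Scope quotient_scope.

(** Write [k x y = W (x - y)], and let [f] be the density of a minimiser,
    [V x] the integral of [k x y * f y] in [y].  The interaction energy is
    quadratic and the internal energy is convex, so comparing [f] with
    [(1 - e) f + e g] and letting [e] tend to [0] shows that [f] minimises, among
    all densities [g] for which the internal energy is finite, the functional
      [E g = int (beta^-1 / (m - 1) * g^m + V * g)],
    in which [V] is frozen.  This functional is strictly convex and has an
    explicit minimiser: for the constant [c] that gives it unit mass,
      [u = (kappa * max 0 (c - V))^(1 / (m - 1))],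
      [kappa = beta (m - 1) / m].
    Hence [f = u] almost everywhere ([euler_lagrange]).  Such a [c] exists by the
    intermediate value theorem ([profile_mass]), and the uniqueness of the
    minimiser is the equality case of Young's inequality ([powR_tangent]).

    Regularity is now read off the formula.  The potential [W] is C^1 and
    periodic, hence Lipschitz, and so is [V], with the same constant because [f]
    is a probability density.  Therefore [u^(m - 1)] is Lipschitz with a constant
    proportional to [beta], and [u] is Holder continuous with the exponent
    [min (1/2) (1 / (m - 1))], the same for all [beta].

    For [beta <= b] the bounds are uniform: [u] has unit mass, so it is at most
    [2 / L^d] somewhere, and the Lipschitz bound on [u^(m - 1)] extends this to a
    bound everywhere ([minimiser_regularity]).  Functions on the compact torus
    with common bounds and a common Holder modulus form a precompact subset of
    C^0 by the Arzela-Ascoli theorem ([bounded_holder_C0_precompact]). *)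

(** * Real powers *)

(** Strict convexity of [t^m] at the tangent in [t], which is Young's inequality
    with its equality case.  For [s, t > 0], division by [s * t^(m - 1)] turns it
    into [m <= exp ((m - 1) x) + (m - 1) exp (- x)] for [x = ln s - ln t], and this
    follows from [1 + y <= exp y] at [y = (m - 1) x] and at [y = - x]. *)
Lemma powR_tangent (R : realType) (m s t : R) : 1 < m -> 0 <= s -> 0 <= t ->
  m * s * t `^ (m - 1) <= s `^ m + (m - 1) * t `^ m ?= iff (s == t).
Proof.
move=> m1; have m0 : 0 < m by apply: lt_trans m1.
have mB0 : 0 < m - 1 by rewrite subr_gt0.
rewrite le_eqVlt => /predU1P[<-|s0].
  rewrite le_eqVlt => /predU1P[<-|t0].
    apply/leifP; rewrite eqxx (powR0 (lt0r_neq0 m0)) (powR0 (lt0r_neq0 mB0)).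
    by rewrite !mulr0 addr0.
  apply/leifP; rewrite lt_eqF// mulr0 mul0r (powR0 (lt0r_neq0 m0)) add0r.
  by rewrite mulr_gt0// powR_gt0.
rewrite le_eqVlt => /predU1P[<-|t0].
  apply/leifP; rewrite gt_eqF// (powR0 (lt0r_neq0 m0)) (powR0 (lt0r_neq0 mB0)) !mulr0 addr0.
  by rewrite powR_gt0.
have [->|st] := eqVneq s t.
  by apply/leifP; rewrite -mulrA mulr_powRB1 ?ltW// mulrBl mul1r subrKC.
apply/leifP.
pose x := ln s - ln t; pose w := ln s + (m - 1) * ln t.
have x0 : x != 0.
  by apply: contra st; rewrite subr_eq0 => /eqP/ln_inj; rewrite !posrE => ->.
have -> : m * s * t `^ (m - 1) = expR w * m.
  by rewrite /powR gt_eqF// -{1}(@lnK _ s) ?posrE// -mulrA -expRD mulrC.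
have -> : s `^ m + (m - 1) * t `^ m
          = expR w * (expR ((m - 1) * x) + (m - 1) * expR (- x)).
  rewrite /powR !gt_eqF// mulrDr mulrCA -!expRD; congr (expR _ + _ * expR _);
    rewrite /w /x; ring.
rewrite ltr_pM2l ?expR_gt0//.
have h1 := expR_ge1Dx ((m - 1) * x).
have h2 : 1 + - x < expR (- x) by apply: expR_gt1Dx; rewrite oppr_eq0.
have : (m - 1) * (1 + - x) < (m - 1) * expR (- x) by rewrite ltr_pM2l.
lra.
Qed.

(** For [z] equal to [x] or [y], the ratio [z / (x + y)] lies in [0, 1] and so is
    at most its [p]-th power; the two inequalities add up. *)
Lemma powR_subadditive (R : realType) (p x y : R) : 0 < p <= 1 ->
  0 <= x -> 0 <= y -> (x + y) `^ p <= x `^ p + y `^ p.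
Proof.
move=> /andP[p0 p1] x0 y0.
have [xy0|xy0] := eqVneq (x + y) 0.
  by rewrite xy0 powR0 ?gt_eqF// addr_ge0// powR_ge0.
have {}xy0 : 0 < x + y by rewrite lt_neqAle eq_sym xy0 addr_ge0.
have aux z : 0 <= z <= x + y -> z / (x + y) * (x + y) `^ p <= z `^ p.
  move=> /andP[z0 zxy]; set u := z / (x + y).
  have u01 : 0 <= u <= 1.
    by rewrite divr_ge0 ?(ltW xy0)//= ler_pdivrMr// mul1r.
  have -> : z = u * (x + y) by rewrite divfK// gt_eqF.
  rewrite powRM ?(ltW xy0)//; last by case/andP: u01.
  rewrite ler_wpM2r ?powR_ge0//.
  have [->|un0] := eqVneq u 0; first by rewrite powR_ge0.
  rewrite -{1}(@powRr1 _ u); last by case/andP: u01.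
  by apply: ger_powR => //; rewrite lt_neqAle eq_sym un0.
have hx := aux x; have hy := aux y.
have := lerD (hx _) (hy _); rewrite x0 y0 lerDl lerDr y0 x0 => /(_ isT isT).
by rewrite -mulrDl -mulrDl divff ?mul1r// gt_eqF.
Qed.

(** Subadditivity gives the exponent [p] when [p <= 1], and the tangent inequality
    gives a Lipschitz bound when [p > 1].  On a bounded interval either exponent
    can be lowered to [a], at the price of a power of [M]. *)
Lemma powR_holder (R : realType) (p a M : R) : 0 < a -> a <= p -> a < 1 ->
  exists2 C : R, 0 <= C & forall s t, 0 <= s <= M -> 0 <= t <= M ->
    `|s `^ p - t `^ p| <= C * `|s - t| `^ a.
Proof.
move=> a0 ap a1.
have p0 : 0 < p by apply: lt_le_trans ap.
suff [C C0 HC] : exists2 C : R, 0 <= C & forall s t, 0 <= t -> t <= s -> s <= M ->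
    s `^ p - t `^ p <= C * (s - t) `^ a.
  exists C => // s t /andP[s0 sM] /andP[t0 tM].
  wlog ts : s t s0 sM t0 tM / t <= s.
    move=> H; have [/H|/ltW/H] := leP t s; first exact.
    by rewrite distrC (distrC t); exact.
  rewrite (ger0_norm (_ : 0 <= s - t)) ?subr_ge0// ger0_norm ?HC//.
  by rewrite subr_ge0 ge0_ler_powR// ?ltW.
have split_pow (q z : R) : a <= q -> 0 <= z <= M -> z `^ q <= M `^ (q - a) * z `^ a.
  move=> aq /andP[z0 zM].
  have -> : z `^ q = z `^ (q - a) * z `^ a.
    by rewrite -powRD subrK// gt_eqF// (lt_le_trans a0).
  rewrite ler_wpM2r ?powR_ge0// ge0_ler_powR// ?subr_ge0// nnegrE//.
  exact: le_trans zM.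
have [p1|p1] := leP p 1.
  exists (M `^ (p - a)); rewrite ?powR_ge0// => s t t0 ts sM.
  apply: le_trans (split_pow _ _ ap _); last first.
    by rewrite subr_ge0 ts/= (le_trans _ sM)// lerBlDr lerDl.
  rewrite lerBlDl -{1}(subrKC t s) powR_subadditive ?p0 ?p1 ?subr_ge0//.
exists (p * M `^ (p - 1) * M `^ (1 - a)).
  by rewrite !mulr_ge0 ?powR_ge0// ltW.
move=> s t t0 ts sM; have s0 := le_trans t0 ts.
have h : s `^ p - t `^ p <= p * s `^ (p - 1) * (s - t).
  have := (powR_tangent p1 t0 s0).1.
  have sE := mulr_powRB1 s0 p0; rewrite -sE; lra.
apply: (le_trans h); rewrite -!mulrA ler_pM2l//.
apply: ler_pM; rewrite ?powR_ge0 ?subr_ge0//.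
  by rewrite ge0_ler_powR ?nnegrE ?subr_ge0 ?(ltW p1) ?(le_trans s0 sM).
rewrite -{1}(@powRr1 _ (s - t)) ?subr_ge0//; apply: split_pow; first exact: ltW.
by rewrite subr_ge0 ts/= (le_trans _ sM)// lerBlDr lerDl.
Qed.

(** * Integrable functions and potentials *)

Section integrable_real.
Context d (T : measurableType d) (R : realType).
Variable mu : {finite_measure set T -> \bar R}.
Implicit Types f g h : T -> R.

Local Notation L1 f := (mu.-integrable setT (EFin \o f)).

Lemma L1_measurable f : L1 f -> measurable_fun setT f.
Proof. by move=> /(measurable_int mu)/measurable_EFinP. Qed.

Lemma L1_add f g : L1 f -> L1 g -> L1 (fun x => f x + g x).
Proof. by move=> fi gi; exact: (integrableD measurableT fi gi). Qed.

Lemma L1_sub f g : L1 f -> L1 g -> L1 (fun x => f x - g x).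
Proof. by move=> fi gi; exact: (integrableB measurableT fi gi). Qed.

Lemma L1_scale f a : L1 f -> L1 (fun x => a * f x).
Proof. by move=> fi; exact: (integrableZl measurableT a fi). Qed.

Lemma bounded_image_norm h B : (forall x, `|h x| <= B) -> [bounded h x | x in setT].
Proof.
move=> hB; exists B; split; first by rewrite num_real.
by move=> M BM x _ /=; rewrite (le_trans (hB x))// ltW.
Qed.

Lemma L1_mul h f B : measurable_fun setT h -> (forall x, `|h x| <= B) ->
  L1 f -> L1 (fun x => h x * f x).
Proof.
move=> mh hB fi.
exact: (integrableMr measurableT mh (bounded_image_norm hB) fi).
Qed.

Lemma L1_bounded h B : measurable_fun setT h -> (forall x, `|h x| <= B) -> L1 h.
Proof.
move=> mh hB; apply: measurable_bounded_integrable => //.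
- by rewrite -ge0_fin_numE// fin_num_measure.
- exact: bounded_image_norm hB.
Qed.

Lemma L1_le f g : measurable_fun setT f -> (forall x, `|f x| <= g x) ->
  L1 g -> L1 f.
Proof.
move=> mf fg; apply: le_integrable => //; first exact/measurable_EFinP.
by move=> x _ /=; rewrite lee_fin (le_trans (fg x))// ler_norm.
Qed.

Lemma L1_ext f g : f =1 g -> L1 f -> L1 g.
Proof. by move=> /funext ->. Qed.

Lemma Rintegral_ae_eq f g : L1 f -> measurable_fun setT g ->
  {ae mu, forall x, f x = g x} -> \int[mu]_x f x = \int[mu]_x g x.
Proof.
move=> fi mg fg; congr fine; apply: ae_eq_integral => //.
- exact: measurable_int fi.
- exact/measurable_EFinP.
- by apply: filterS fg => x -> _.
Qed.

Lemma Rintegral_eq0 f : L1 f -> (forall x, 0 <= f x) -> \int[mu]_x f x <= 0 ->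
  {ae mu, forall x, f x = 0}.
Proof.
move=> fi f0 If0.
have : ae_eq mu setT (EFin \o f) (cst 0%E).
  apply/(ae_eq_integral_abs mu measurableT (measurable_int _ fi)).
  under eq_integral do rewrite /= ger0_norm//.
  rewrite -[LHS]fineK ?(integrable_fin_num measurableT fi)//; congr EFin.
  by apply/eqP; rewrite eq_le If0 Rintegral_ge0.
by apply: filterS => x /(_ I) [].
Qed.

End integrable_real.

Section potential.
Context d (T : measurableType d) (R : realType).
Variable mu : {finite_measure set T -> \bar R}.
Variables (k : T -> T -> R) (B : R).
Hypothesis mk : measurable_fun setT (fun z : T * T => k z.1 z.2).
Hypothesis kB : forall x y, `|k x y| <= B.
Implicit Types f g : T -> R.

Local Notation L1 f := (mu.-integrable setT (EFin \o f)).

Definition potential f x := \int[mu]_y (k x y * f y).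

Lemma measurable_kernel_section x : measurable_fun setT (k x).
Proof. exact: (measurableT_comp mk (measurable_pair1 x)). Qed.

Lemma L1_kernel x f : L1 f -> L1 (fun y => k x y * f y).
Proof. by apply: L1_mul; [exact: measurable_kernel_section|exact: kB]. Qed.

Lemma potential_le f x : L1 f -> `|potential f x| <= B * \int[mu]_y `|f y|.
Proof.
move=> fi; have nfi := integrable_norm fi.
apply: le_trans (le_normr_Rintegral _ (L1_kernel x fi)) _ => //.
rewrite -RintegralZl//; apply: le_Rintegral => //.
- exact: (integrable_norm (L1_kernel x fi)).
- exact: (L1_scale B nfi).
- by move=> y _; rewrite normrM ler_wpM2r.
Qed.

Lemma potential_lin f g a b x : L1 f -> L1 g ->
  potential (fun y => a * f y + b * g y) x = a * potential f x + b * potential g x.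
Proof.
move=> fi gi; rewrite /potential -!RintegralZl//; try exact: L1_kernel.
rewrite -RintegralD//; try exact/L1_scale/L1_kernel.
by congr fine; apply: eq_integral => y _; congr EFin; ring.
Qed.

(** The potential sees only the almost-everywhere class of a density, which is why
    the choice of a density does not matter for the energy. *)
Lemma potential_ae f g : L1 f -> measurable_fun setT g ->
  {ae mu, forall x, f x = g x} -> potential f =1 potential g.
Proof.
move=> fi mg fg x; apply: Rintegral_ae_eq.
- exact: L1_kernel.
- exact: measurable_funM (measurable_kernel_section _) mg.
- by apply: filterS fg => y ->.
Qed.

Let prod_measurable f g : measurable_fun setT f -> measurable_fun setT g ->
  measurable_fun setT (fun z : T * T => k z.1 z.2 * f z.1 * g z.2).
Proof.
move=> mf mg; apply: measurable_funM; first apply: measurable_funM => //.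
- exact: (measurableT_comp mf measurable_fst).
- exact: (measurableT_comp mg measurable_snd).
Qed.

(** The kernel is bounded, so the integrand is dominated by [B * |f| * |g|], whose
    iterated integral is finite. *)
Lemma integrable_interaction f g : L1 f -> L1 g ->
  (mu \x mu)%E.-integrable setT
    (fun z : T * T => (k z.1 z.2 * f z.1 * g z.2)%:E).
Proof.
move=> fi gi.
have mf := L1_measurable fi; have mg := L1_measurable gi.
apply/integrable12ltyP; first by apply/measurable_EFinP; exact: prod_measurable.
pose If := \int[mu]_y `|g y|.
apply: (@le_lt_trans _ _ (\int[mu]_x (B * If * `|f x|)%:E)%E); last first.
  have := L1_scale (B * If) (integrable_norm fi).
  move=> /(integrable_fin_num measurableT) /=.
  by rewrite fin_numE => /andP[_]; rewrite ltey.
apply: ge0_le_integral => //.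
- by move=> x _; exact: integral_ge0.
- apply: (measurable_fun_fubini_tonelli_F (abse \o
    (fun z : T * T => (k z.1 z.2 * f z.1 * g z.2)%:E))) => [|z]; last exact: abse_ge0.
  by apply/measurableT_comp => //; apply/measurable_EFinP; exact: prod_measurable.
- apply/measurable_EFinP; apply: measurable_funM => //.
  exact: measurableT_comp.
- move=> x _ /=.
  apply: (@le_trans _ _ (\int[mu]_y (B * `|f x| * `|g y|)%:E)%E).
    apply: ge0_le_integral => //.
    + apply/measurable_EFinP; apply: measurableT_comp => //.
      by apply: measurable_funM => //; apply: measurable_funM => //;
        exact: measurable_kernel_section.
    + apply/measurable_EFinP; apply: measurable_funM => //.
      exact: measurableT_comp.
    + by move=> y _; rewrite lee_fin !normrM !ler_wpM2r.
  have := L1_scale (B * `|f x|) (integrable_norm gi).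
  move=> /(integrable_fin_num measurableT) /fineK <-.
  rewrite lee_fin -/(Rintegral _ _ _) RintegralZl//; last exact: integrable_norm.
  by rewrite -mulrA (mulrC `|f x|) mulrA.
Qed.

(** Fubini's theorem for the density [1] in the first variable. *)
Lemma potential_integrable f : L1 f -> L1 (potential f).
Proof.
move=> fi.
have ci : L1 (cst 1) by exact: finite_measure_integrable_cst.
have := integrable_fubini_F (integrable_interaction ci fi).
apply: eq_integrable => // x _.
rewrite /fubini_F /potential /= /Rintegral fineK.
  by apply: eq_integral => y _; rewrite mulr1.
exact: (integrable_fin_num measurableT (L1_kernel x fi)).
Qed.

Lemma measurable_potential f : L1 f -> measurable_fun setT (potential f).
Proof. by move=> /potential_integrable; exact: L1_measurable. Qed.

Lemma L1_mul_potential f g : L1 f -> L1 g -> L1 (fun x => f x * potential g x).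
Proof.
move=> fi gi; apply: (@L1_ext _ _ _ _ (fun x => potential g x * f x)).
  by move=> x; rewrite mulrC.
apply: L1_mul fi; first exact: measurable_potential.
by move=> x; exact: potential_le.
Qed.

(** Reduces every statement about the double integral to single integrals against
    the potential. *)
Lemma interactionE f g : L1 f -> L1 g ->
  (\int[mu \x mu]_z (k z.1 z.2 * f z.1 * g z.2)%:E
   = (\int[mu]_x (f x * potential g x))%:E)%E.
Proof.
move=> fi gi.
rewrite -integral12_prod_meas1; last exact: integrable_interaction.
rewrite /Rintegral fineK; last first.
  exact: (integrable_fin_num measurableT (L1_mul_potential fi gi)).
apply: eq_integral => x _; rewrite /fubini_F /= /potential.
rewrite -RintegralZl//; last exact: L1_kernel.
rewrite /Rintegral fineK; last first.
  exact: (integrable_fin_num measurableT (L1_scale (f x) (L1_kernel x gi))).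
by apply: eq_integral => y _; rewrite mulrAC mulrA (mulrC (f x)) mulrAC.
Qed.

Lemma interaction_sym f g : (forall x y, k x y = k y x) -> L1 f -> L1 g ->
  \int[mu]_x (f x * potential g x) = \int[mu]_x (g x * potential f x).
Proof.
move=> ksym fi gi; apply: EFin_inj; rewrite -interactionE//.
rewrite -integral21_prod_meas1; last exact: integrable_interaction.
rewrite -interactionE// -integral12_prod_meas1; last exact: integrable_interaction.
apply: eq_integral => y _; apply: eq_integral => x _ /=.
by rewrite ksym mulrAC.
Qed.

End potential.

(** * Equilibrium profiles of a given potential *)

(** Turns a Holder bound into an explicit modulus of continuity. *)
Lemma powR_small (R : realType) (a C e : R) : 0 < a -> 0 <= C -> 0 < e ->
  exists2 delta, 0 < delta & forall z, 0 <= z <= delta -> C * z `^ a <= e.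
Proof.
move=> a0 C0 e0; have C1 : 0 < C + 1 by rewrite ltr_wpDl.
exists ((e / (C + 1)) `^ a^-1); first by rewrite powR_gt0// divr_gt0.
move=> z /andP[z0 zd]; apply: (@le_trans _ _ ((C + 1) * (e / (C + 1)))).
  apply: ler_pM; rewrite ?powR_ge0// ?lerDl//.
  have -> : e / (C + 1) = ((e / (C + 1)) `^ a^-1) `^ a.
    by rewrite -powRrM mulVf ?gt_eqF// powRr1// ltW// divr_gt0.
  by rewrite ge0_ler_powR ?nnegrE ?powR_ge0// ltW.
by rewrite mulrC divfK// gt_eqF.
Qed.

Lemma max0_lipschitz (R : realType) (x y : R) :
  `|Num.max 0 x - Num.max 0 y| <= `|x - y|.
Proof.
have [xy|xy] := leP y x.
  rewrite (ger0_norm (_ : 0 <= x - y)) ?subr_ge0// ler_norml.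
  by case: (leP 0 x) => ?; case: (leP 0 y) => ?; apply/andP; split; lra.
rewrite (ltr0_norm (_ : x - y < 0)) ?subr_lt0// ler_norml.
by case: (leP 0 x) => ?; case: (leP 0 y) => ?; apply/andP; split; lra.
Qed.

Section profile.
Context (R : realType) (m beta : R).
Hypotheses (m_gt1 : 1 < m) (beta_gt0 : 0 < beta).

(** The inverse of the coefficient [m / (beta (m - 1))] in the derivative of the
    internal energy density [t |-> beta^-1 / (m - 1) * t^m]. *)
Definition stiffness : R := beta * ((m - 1) / m).

Lemma stiffness_gt0 : 0 < stiffness.
Proof.
by rewrite mulr_gt0// divr_gt0 ?subr_gt0// (lt_trans _ m_gt1).
Qed.

(** For fixed [x] this is the minimiser over [t >= 0] of
    [beta^-1 / (m - 1) * t^m + (V x - c) * t]. *)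
Definition profile T (V : T -> R) (c : R) (x : T) : R :=
  (stiffness * Num.max 0 (c - V x)) `^ (m - 1)^-1.

Lemma profile_ge0 T (V : T -> R) c x : 0 <= profile V c x.
Proof. exact: powR_ge0. Qed.

Lemma profile_powB1 T (V : T -> R) c x :
  profile V c x `^ (m - 1) = stiffness * Num.max 0 (c - V x).
Proof.
rewrite -powRrM mulVf ?powRr1// ?gt_eqF ?subr_gt0//.
by rewrite mulr_ge0 ?(ltW stiffness_gt0)// le_max lexx.
Qed.

Lemma profile_arg_ge0 T (V : T -> R) c x : 0 <= stiffness * Num.max 0 (c - V x).
Proof. by rewrite mulr_ge0 ?(ltW stiffness_gt0)// le_max lexx. Qed.

(** The left-hand side is the Bregman divergence of the internal energy between [s]
    and the profile.  Where the profile is positive, stationarity turns the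
    inequality into an equality; where it vanishes, [V x - c] is nonnegative and
    multiplies [s >= 0]. *)
Lemma profile_bregman T (V : T -> R) c x (s : R) : 0 <= s ->
  beta^-1 / (m - 1) * (s `^ m + (m - 1) * profile V c x `^ m
    - m * s * profile V c x `^ (m - 1))
  <= beta^-1 / (m - 1) * (s `^ m - profile V c x `^ m)
     + (V x - c) * (s - profile V c x).
Proof.
move=> s0; set t := profile V c x.
have m0 : 0 < m by apply: lt_trans m_gt1.
have mB0 : 0 < m - 1 by rewrite subr_gt0.
have t0 : 0 <= t by exact: powR_ge0.
rewrite -(mulr_powRB1 t0 m0) profile_powB1 -/t.
set w := Num.max 0 (c - V x).
(* the stiffness cancels the coefficient of the derivative of the internal energy *)
have bE : beta^-1 / (m - 1) * (m * stiffness) = 1.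
  rewrite /stiffness; field; rewrite !gt_eqF//.
rewrite -subr_ge0 (_ : _ - _ = (V x - c + w) * (s - t)); last first.
  transitivity ((V x - c) * (s - t) +
    (beta^-1 / (m - 1) * (m * stiffness)) * w * (s - t)); last by rewrite bE; ring.
  by ring.
rewrite /w; case: (leP 0 (c - V x)) => [_|cV].
  by rewrite addrA subrK subrr mul0r.
have -> : t = 0.
  rewrite /t /profile (max_idPl (ltW cV)) mulr0 powR0//.
  by rewrite invr_eq0 gt_eqF.
by rewrite addr0 subr0 mulr_ge0// ltW// -oppr_lt0 opprB.
Qed.

End profile.

Lemma holder_continuous_within (R : realType) (a C u v : R) (G : R -> R) :
  0 < a -> 0 <= C ->
  {in `[u, v] &, forall x y, `|G x - G y| <= C * `|x - y| `^ a} ->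
  {within `[u, v], continuous G}.
Proof.
move=> a0 C0 HG; apply/subspace_continuousP => x xuv.
apply/cvgrPdist_le => e e0; have [dl dl0 Hd] := powR_small a0 C0 e0.
rewrite near_withinE; near=> y => yuv.
apply: (le_trans (HG _ _ xuv yuv)); apply: Hd; rewrite normr_ge0/=.
by near: y; apply: cvgr_dist_le.
Unshelve. all: by end_near. Qed.

Lemma IVT_le (R : realType) (G : R -> R) (u v w : R) : u <= v ->
  {within `[u, v], continuous G} -> G u <= w -> w <= G v -> exists c, G c = w.
Proof.
move=> uv cG Gu Gv; have [|c _ Gc] := IVT (v := w) uv cG; last by exists c.
by rewrite ge_min Gu le_max Gv orbT.
Qed.

Section chemical_potential.
Context d (T : measurableType d) (R : realType).
Variable mu : {finite_measure set T -> \bar R}.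
Variables (m beta : R).
Hypotheses (m_gt1 : 1 < m) (beta_gt0 : 0 < beta).
Variables (V : T -> R) (B : R).
Hypotheses (mV : measurable_fun setT V) (VB : forall x, `|V x| <= B).

Local Notation L1 f := (mu.-integrable setT (EFin \o f)).
Local Notation u_ := (profile m beta V).
Local Notation kappa := (stiffness m beta).

Lemma measurable_profile c : measurable_fun setT (u_ c).
Proof.
apply: (measurableT_comp (measurable_powR _)).
apply: measurable_funM => //; apply: measurable_maxr => //.
exact: measurable_funB.
Qed.

Lemma profile_arg_le c b x : c <= b -> 0 <= b + B ->
  0 <= kappa * Num.max 0 (c - V x) <= kappa * (b + B).
Proof.
move=> cb bB; rewrite profile_arg_ge0//= ler_pM2l ?stiffness_gt0//.
by rewrite ge_max bB/=; have := VB x; rewrite ler_norml => /andP[]; lra.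
Qed.

Lemma profile_le c b x : c <= b -> 0 <= b + B ->
  u_ c x <= (kappa * (b + B)) `^ (m - 1)^-1.
Proof.
move=> cb bB; have /andP[h1 h2] := profile_arg_le x cb bB.
apply: ge0_ler_powR; rewrite ?nnegrE ?invr_ge0 ?subr_ge0 ?(ltW m_gt1)//.
exact: le_trans h2.
Qed.

Lemma L1_profile c : L1 (u_ c).
Proof.
have bB : 0 <= Num.max c (- B) + B by rewrite -lerBlDr sub0r le_max lexx orbT.
apply: (L1_bounded mu (B := (kappa * (Num.max c (- B) + B)) `^ (m - 1)^-1)).
  exact: measurable_profile.
by move=> x; rewrite ger0_norm ?profile_ge0// profile_le// le_max lexx.
Qed.

(** The mass of the profile is a Holder function of [c], so the intermediate value
    theorem applies: it vanishes at [c = - B], and it is at least [1] when [c] is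
    so large that the profile is at least [1 / mu(T)] everywhere. *)
Lemma profile_mass : 0 < fine (mu setT) -> exists c, \int[mu]_x u_ c x = 1.
Proof.
set M := fine _ => M0.
have k0 : 0 < kappa by exact: stiffness_gt0.
have mB0 : 0 < m - 1 by rewrite subr_gt0.
have p0 : 0 < (m - 1)^-1 by rewrite invr_gt0.
(* the value of [c - V] at which the profile is the uniform density [M^-1] *)
pose s := M^-1 `^ (m - 1) / kappa.
have s0 : 0 < s by rewrite divr_gt0// powR_gt0// invr_gt0.
have BB : - B <= B.
  by have := VB point; rewrite ler_norml => /andP[]; exact: le_trans.
have ab : - B <= B + s by rewrite (le_trans BB)// lerDl ltW.
have B0 : 0 <= (B + s) + B by rewrite -lerBlDr sub0r.
pose a := Num.min 2^-1 (m - 1)^-1.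
have a0 : 0 < a by rewrite lt_min p0 invr_gt0 ltr0n.
have a1 : a < 1 by rewrite gt_min invf_lt1 ?ltr1n.
have ap : a <= (m - 1)^-1 by rewrite ge_min lexx orbT.
have [C C0 HC] := powR_holder (kappa * (B + s + B)) a0 ap a1.
have cont : {within `[- B, B + s], continuous (fun c => \int[mu]_x u_ c x)}.
  apply: (@holder_continuous_within _ a (C * kappa `^ a * M)) => //.
    by rewrite !mulr_ge0 ?powR_ge0// ltW.
  move=> c c' /itvP hc /itvP hc'.
  have ic := L1_profile c; have ic' := L1_profile c'.
  rewrite -RintegralB//.
  apply: le_trans (le_normr_Rintegral _ (L1_sub ic ic')) _ => //.
  rewrite mulrAC -(Rintegral_cst mu measurableT); apply: le_Rintegral => //.
  - exact: integrable_norm (L1_sub ic ic').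
  - exact: finite_measure_integrable_cst.
  - move=> x _; apply: (le_trans (HC _ _ _ _)).
    + by apply: profile_arg_le => //; rewrite hc.
    + by apply: profile_arg_le => //; rewrite hc'.
    + rewrite -(mulrA C) ler_wpM2l// -powRM ?normr_ge0 ?(ltW k0)//.
      apply: ge0_ler_powR; rewrite ?nnegrE ?normr_ge0 ?(ltW a0)//.
        by rewrite mulr_ge0 ?(ltW k0).
      rewrite -mulrBr normrM (gtr0_norm k0) ler_pM2l//.
      apply: le_trans (max0_lipschitz _ _) _.
      by rewrite opprB addrA addrNK.
have lo : \int[mu]_x u_ (- B) x <= 1.
  rewrite (_ : \int[mu]_x _ = 0) ?ler01//.
  rewrite /Rintegral integral0_eq// => x _; congr EFin.
  rewrite /profile (max_idPl _) ?mulr0 ?powR0 ?gt_eqF//.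
  by have := VB x; rewrite ler_norml => /andP[]; lra.
have hi : 1 <= \int[mu]_x u_ (B + s) x.
  have -> : 1 = \int[mu]_(x in setT) M^-1.
    by rewrite Rintegral_cst// mulVf// gt_eqF.
  apply: le_Rintegral => //.
  - exact: finite_measure_integrable_cst.
  - exact: L1_profile.
  - move=> x _; have -> : M^-1 = (kappa * s) `^ (m - 1)^-1.
      rewrite /s mulrC divfK ?gt_eqF// -powRrM divff ?gt_eqF//.
      by rewrite powRr1// invr_ge0 ltW.
    apply: ge0_ler_powR; rewrite ?nnegrE ?profile_arg_ge0 ?(ltW p0)//.
      by rewrite mulr_ge0 ?ltW.
    rewrite ler_pM2l// le_max; apply/orP; right.
    by have := VB x; rewrite ler_norml => /andP[]; lra.
exact: IVT_le ab cont lo hi.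
Qed.

End chemical_potential.

(** * The Euler-Lagrange equation *)

Lemma powR_convex (R : realType) (m e s t : R) : 1 < m -> 0 <= e <= 1 ->
  0 <= s -> 0 <= t ->
  ((1 - e) * s + e * t) `^ m <= (1 - e) * s `^ m + e * t `^ m.
Proof.
move=> m1 /andP[e0 e1] s0 t0; set w := _ + _.
have ce0 : 0 <= 1 - e by rewrite subr_ge0.
have w0 : 0 <= w by rewrite addr_ge0 ?mulr_ge0.
have wm := mulr_powRB1 w0 (lt_trans ltr01 m1).
have hs := ler_wpM2l ce0 (powR_tangent m1 s0 w0).1.
have ht := ler_wpM2l e0 (powR_tangent m1 t0 w0).1.
have := lerD hs ht.
rewrite (_ : _ + e * (m * t * _) = m * (w * w `^ (m - 1))); last by rewrite /w; ring.
by rewrite wm; lra.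
Qed.

(** The limit [e -> 0] in first-order conditions: if [A < 0] then [B > 0] by the
    case [e = 1], and [e = - A / (B - A)] gives the value [- A^2 / (B - A) < 0]. *)
Lemma affine_ge0 (R : realType) (A B : R) :
  (forall e, 0 < e <= 1 -> 0 <= A + e * B) -> 0 <= A.
Proof.
move=> H; rewrite leNgt; apply/negP => A0.
have B0 : 0 < B by have := H 1; rewrite ltr01 lexx => /(_ isT); lra.
pose e := - A / (- A + B).
have D0 : 0 < - A + B by rewrite addr_gt0// oppr_gt0.
have : 0 < e <= 1.
  by rewrite divr_gt0 ?oppr_gt0//= ler_pdivrMr// mul1r lerDl ltW.
move=> /H; rewrite (_ : A + e * B = - (A * A) / (- A + B)).
  rewrite pmulr_lge0 ?invr_gt0// oppr_ge0 leNgt => /negP; apply.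
  by rewrite -expr2 exprn_even_gt0//= lt_eqF.
by rewrite /e; field; rewrite gt_eqF.
Qed.

Section euler_lagrange.
Context d (T : measurableType d) (R : realType).
Variable mu : {finite_measure set T -> \bar R}.
Variables (m beta : R).
Hypotheses (m_gt1 : 1 < m) (beta_gt0 : 0 < beta).
Variables (k : T -> T -> R) (B : R).
Hypothesis mk : measurable_fun setT (fun z : T * T => k z.1 z.2).
Hypothesis kB : forall x y, `|k x y| <= B.
Hypothesis ksym : forall x y, k x y = k y x.
Hypothesis mu_gt0 : 0 < fine (mu setT).

Local Notation L1 f := (mu.-integrable setT (EFin \o f)).

Definition admissible (f : T -> R) :=
  [/\ L1 f, forall x, 0 <= f x, \int[mu]_x f x = 1 & L1 (fun x => f x `^ m)].

Definition energy (f : T -> R) : R :=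
  beta^-1 / (m - 1) * \int[mu]_x (f x `^ m)
  + 2^-1 * \int[mu]_x (f x * potential mu k f x).

Lemma admissible_bounded (f : T -> R) (M : R) : measurable_fun setT f ->
  (forall x, 0 <= f x <= M) -> \int[mu]_x f x = 1 -> admissible f.
Proof.
move=> mf fM If; split=> //.
- apply: (L1_bounded mu (B := M)) => // x.
  by have /andP[h1 h2] := fM x; rewrite ger0_norm.
- by move=> x; have /andP[] := fM x.
- apply: (L1_bounded mu (B := M `^ m)).
    exact: measurableT_comp (measurable_powR _) mf.
  move=> x; have /andP[h1 h2] := fM x.
  rewrite ger0_norm ?powR_ge0//.
  by apply: ge0_ler_powR; rewrite ?nnegrE ?(le_trans h1 h2)// ltW// (lt_trans ltr01).
Qed.

Lemma admissible_mix (f g : T -> R) (e : R) : 0 <= e <= 1 ->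
  admissible f -> admissible g -> admissible (fun x => (1 - e) * f x + e * g x).
Proof.
move=> e01 [fi f0 If fm] [gi g0 Ig gm]; have /andP[e0 e1] := e01.
have ce0 : 0 <= 1 - e by rewrite subr_ge0.
have hi := L1_add (L1_scale (1 - e) fi) (L1_scale e gi).
split=> //.
- by move=> x; rewrite addr_ge0 ?mulr_ge0.
- rewrite RintegralD//; [|exact: L1_scale..].
  by rewrite !RintegralZl// If Ig !mulr1 subrK.
- apply: (L1_le _ _ (L1_add (L1_scale (1 - e) fm) (L1_scale e gm))).
    exact: measurableT_comp (measurable_powR _) (L1_measurable hi).
  by move=> x; rewrite ger0_norm ?powR_ge0// powR_convex.
Qed.

(** Only the coefficient of [e] matters for the first-order condition; the
    convexity of the internal energy makes this an upper bound without any
    differentiation under the integral. *)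
Lemma energy_mix (f g : T -> R) (e : R) : 0 <= e <= 1 ->
  admissible f -> admissible g ->
  energy (fun x => (1 - e) * f x + e * g x) <= energy f + e *
   (beta^-1 / (m - 1) * (\int[mu]_x (g x `^ m) - \int[mu]_x (f x `^ m))
    + (\int[mu]_x (g x * potential mu k f x) - \int[mu]_x (f x * potential mu k f x)))
   + e ^+ 2 * 2^-1 * (\int[mu]_x (f x * potential mu k f x)
      - 2 * \int[mu]_x (g x * potential mu k f x)
      + \int[mu]_x (g x * potential mu k g x)).
Proof.
move=> e01 af ag; have [hi _ _ hm] := admissible_mix e01 af ag.
have [fi f0 If fm] := af; have [gi g0 Ig gm] := ag.
pose J u v := \int[mu]_x (u x * potential mu k v x).
have JL u v : L1 u -> L1 v -> L1 (fun x => u x * potential mu k v x).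
  by move=> ui vi; exact: (L1_mul_potential mk kB ui vi).
have SE : \int[mu]_x (((1 - e) * f x + e * g x) `^ m)
    <= (1 - e) * \int[mu]_x (f x `^ m) + e * \int[mu]_x (g x `^ m).
  rewrite -!RintegralZl// -RintegralD//; [|exact: L1_scale..].
  apply: le_Rintegral => //; first exact/L1_add/L1_scale/gm/L1_scale/fm.
  by move=> x _; exact: powR_convex.
have JE : J (fun x => (1 - e) * f x + e * g x) (fun x => (1 - e) * f x + e * g x)
   = (1 - e) ^+ 2 * J f f + (1 - e) * e * J f g + e * (1 - e) * J g f
     + e ^+ 2 * J g g.
  rewrite /J -!RintegralZl//; try exact: JL.
  rewrite -!RintegralD//;
    try (by do ?[apply: L1_add]; apply: L1_scale; apply: JL).
  by apply: eq_Rintegral => x _; rewrite (potential_lin mk kB _ _ _ fi gi); ring.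
have Jsym : J f g = J g f by exact: (interaction_sym mk kB ksym fi gi).
rewrite /energy -!/(J _ _) JE Jsym.
have a0 : 0 <= beta^-1 / (m - 1).
  by rewrite divr_ge0 ?invr_ge0 ?subr_ge0 ?(ltW m_gt1) ?(ltW beta_gt0).
have := ler_wpM2l a0 SE.
set If' := \int[mu]_x (f x `^ m); set Ig' := \int[mu]_x (g x `^ m).
set S := \int[mu]_x _; set al := beta^-1 / _.
move: al S If' Ig' (J f f) (J g f) (J g g) => al S If' Ig' Jff Jgf Jgg HS.
rewrite -subr_ge0 (_ : _ - _ = al * ((1 - e) * If' + e * Ig') - al * S).
  by rewrite subr_ge0.
by field.
Qed.

(** Minimality along segments towards the profile [g] of unit mass shows that [f]
    is at least as good as [g] for the energy with frozen potential.  The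
    difference of these energies dominates the integral of the Bregman divergence
    [P] of [f] from [g], so [P = 0] almost everywhere, and strict convexity
    yields [f = g]. *)
Theorem euler_lagrange (f : T -> R) : admissible f ->
  (forall g, admissible g -> energy f <= energy g) ->
  exists2 c, {ae mu, forall x, f x = profile m beta (potential mu k f) c x}
    & \int[mu]_x profile m beta (potential mu k f) c x = 1.
Proof.
move=> af fmin; have [fi f0 If fm] := af.
pose V := potential mu k f; pose VB := B * \int[mu]_y `|f y|.
have mV : measurable_fun setT V by exact: (measurable_potential mk kB fi).
have VBP x : `|V x| <= VB by exact: (potential_le mk kB _ fi).
have [c Ic] := profile_mass m_gt1 beta_gt0 mV VBP mu_gt0.
exists c => //; pose g := profile m beta V c; rewrite -/V -/g in Ic *.
pose b := Num.max c (- VB).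
have ag : admissible g.
  apply: (admissible_bounded (measurable_profile m beta mV c) _ Ic) => x.
  rewrite profile_ge0/=; apply: (profile_le m_gt1 beta_gt0 VBP (b := b)).
    by rewrite le_max lexx.
  by rewrite -lerBlDr sub0r le_max lexx orbT.
have [gi g0 Ig gm] := ag.
set al := beta^-1 / (m - 1).
have JL u v : L1 u -> L1 v -> L1 (fun x => u x * potential mu k v x).
  by move=> ui vi; exact: (L1_mul_potential mk kB ui vi).
have first_order : 0 <= al * (\int[mu]_x (g x `^ m) - \int[mu]_x (f x `^ m))
    + (\int[mu]_x (g x * V x) - \int[mu]_x (f x * V x)).
  apply: affine_ge0 => e /andP[e0 e1].
  have e01 : 0 <= e <= 1 by rewrite ltW.
  have := le_trans (fmin _ (admissible_mix e01 af ag)) (energy_mix e01 af ag).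
  rewrite -/V -/al -addrA -lerBlDl subrr -mulrA expr2 -mulrA -mulrDr pmulr_rge0//.
  exact.
pose D x := al * (f x `^ m - g x `^ m) + (V x - c) * (f x - g x).
pose P x := al * (f x `^ m + (m - 1) * g x `^ m - m * f x * g x `^ (m - 1)).
have al0 : 0 < al by rewrite divr_gt0 ?invr_gt0 ?subr_gt0.
have P0 x : 0 <= P x.
  by rewrite mulr_ge0 ?(ltW al0)// subr_ge0 (powR_tangent m_gt1 (f0 x) (g0 x)).1.
have PD x : P x <= D x by exact: profile_bregman.
(* adding [c (f - g)] is free, since both densities have the same mass *)
pose D' x := (al * (f x `^ m - g x `^ m) + (f x * V x - g x * V x)) - c * (f x - g x).
have DE x : D x = D' x by rewrite /D /D'; ring.
have iS := L1_scale al (L1_sub fm gm).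
have iJ := L1_sub (JL _ _ fi fi) (JL _ _ gi fi).
have iM := L1_scale c (L1_sub fi gi).
have Di : L1 D by apply: (L1_ext (fun x => esym (DE x))); exact: L1_sub (L1_add iS iJ) iM.
have ID : \int[mu]_x D x <= 0.
  have -> : \int[mu]_x D x = \int[mu]_x D' x.
    by apply: eq_Rintegral => x _; exact: DE.
  rewrite RintegralB//; last exact: (L1_add iS iJ).
  rewrite RintegralD// RintegralZl//; last exact: L1_sub.
  rewrite RintegralB// RintegralB//; [|exact: JL..].
  rewrite RintegralZl//; last exact: L1_sub.
  rewrite RintegralB// If Ig subrr mulr0 subr0; move: first_order; rewrite -/V.
  move: (\int[mu]_x _) (\int[mu]_x _) (\int[mu]_x _) (\int[mu]_x _) => *; lra.
have mP : measurable_fun setT P.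
  have mf := L1_measurable fi; have mg := L1_measurable gi.
  apply: measurable_funM => //; apply: measurable_funB.
    by apply: measurable_funD; [|apply: measurable_funM => //];
      apply: (measurableT_comp (measurable_powR _)).
  apply: measurable_funM; first exact: measurable_funM.
  exact: (measurableT_comp (measurable_powR _)).
have Pi : L1 P by apply: (L1_le mP _ Di) => x; rewrite ger0_norm.
have := Rintegral_eq0 Pi P0 (le_trans (le_Rintegral measurableT Pi Di (fun x _ => PD x)) ID).
apply: filterS => x /eqP; rewrite mulf_eq0 gt_eqF//= subr_eq0 eq_sym.
by rewrite (powR_tangent m_gt1 (f0 x) (g0 x)).2 => /eqP.
Qed.

End euler_lagrange.

(** * Lebesgue measure on tuples *)

Section image_measure.
Local Open Scope ereal_scope.
Context d1 d2 (T1 : measurableType d1) (T2 : measurableType d2) (R : realType).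
Variables (m : {measure set T1 -> \bar R}) (f : T1 -> T2).
Hypothesis mf : measurable_fun setT f.

Lemma measurable_preimage A : measurable A -> measurable (f @^-1` A).
Proof. by move=> mA; rewrite -[X in measurable X]setTI; exact: mf. Qed.

Lemma pushforward_semi_sigma_additive :
  semi_sigma_additive (pushforward m f : set T2 -> \bar R).
Proof.
move=> F mF tF mUF; rewrite /pushforward preimage_bigcup.
apply: measure_semi_sigma_additive.
- by move=> n; exact: measurable_preimage.
- apply/trivIsetP => /= i j _ _ ij; rewrite -preimage_setI.
  by move/trivIsetP : tF => /(_ _ _ _ _ ij) ->//; rewrite preimage_set0.
- by rewrite -preimage_bigcup; exact: measurable_preimage.
Qed.

End image_measure.

Lemma bundle_sigma_finite_measure d (T : measurableType d) (R : realType)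
    (nu : set T -> \bar R) :
  nu set0 = 0%E -> (forall A, (0 <= nu A)%E) -> semi_sigma_additive nu ->
  sigma_finite setT nu ->
  {mu : {sigma_finite_measure set T -> \bar R} | mu = nu :> (set T -> \bar R)}.
Proof.
move=> nu0 nu_ge0 nu_add nu_sf.
pose nu' : {measure set T -> \bar R} :=
  HB.pack nu (isMeasure.Build _ _ _ nu nu0 nu_ge0 nu_add).
pose nu'' : {sigma_finite_measure set T -> \bar R} :=
  HB.pack (Measure.sort nu') (Measure_isSigmaFinite.Build _ _ _ nu' nu_sf).
by exists nu''.
Qed.

(** With nondecreasing exhaustions [F] and [G] the diagonal family of products
    [F n * G n] already covers everything. *)
Lemma product_sigma_finite d1 d2 (T1 : measurableType d1)
    (T2 : measurableType d2) (R : realType)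
    (m1 : {sigma_finite_measure set T1 -> \bar R})
    (m2 : {sigma_finite_measure set T2 -> \bar R}) :
  sigma_finite setT (m1 \x m2)%E.
Proof.
have /sigma_finiteP[F [FT Fnd Ffin]] := sigma_finiteT m1.
have /sigma_finiteP[G [GT Gnd Gfin]] := sigma_finiteT m2.
exists (fun n => F n `*` G n); last first.
  move=> n; have [[mF Fn] [mG Gn]] := (Ffin n, Gfin n); split.
    exact: measurableX.
  by rewrite product_measure1E// lte_mul_pinfty// ge0_fin_numE.
apply/seteqP; split=> // -[x y] _.
have [n _ Fx] : (\bigcup_n F n) x by rewrite -FT.
have [p _ Gy] : (\bigcup_n G n) y by rewrite -GT.
exists (n + p)%N => //; split=> /=.
- by move: x Fx; exact/subsetPset/Fnd/leq_addr.
- by move: y Gy; exact/subsetPset/Gnd/leq_addl.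
Qed.

Section lebesgue_tuple.
Local Open Scope ereal_scope.
Context (R : realType).
Local Notation mR := (measurableTypeR R).

Lemma measurable_tuple_cons n :
  measurable_fun setT (fun p : mR * n.-tuple mR => [tuple of p.1 :: p.2]).
Proof. exact: measurable_cons. Qed.

Lemma measurable_tuple_uncons n :
  measurable_fun setT (fun t : n.+1.-tuple mR => (thead t, [tuple of behead t])).
Proof.
apply: measurable_fun_pair; first exact: measurable_tnth.
exact: measurable_behead.
Qed.

Lemma tuple_consK n (p : mR * n.-tuple mR) :
  (thead [tuple of p.1 :: p.2], [tuple of behead [tuple of p.1 :: p.2]]) = p.
Proof. by case: p => x t; congr pair; exact/val_inj. Qed.

(** The recursive definition yields a bare set function; a sigma-finite measure with
    the same values is built along the recursion, because the product with the
    next factor requires sigma-finiteness.  The cells of the pushforward are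
    preimages of product cells under the inverse [t |-> (thead t, behead t)]. *)
Lemma lebesgue_tuple_measure n :
  {mu : {sigma_finite_measure set (n.-tuple mR) -> \bar R} |
    mu = @lebesgue_tuple R n :> (set (n.-tuple mR) -> \bar R)}.
Proof.
elim: n => [|n [mu muE]].
  by exists (@dirac _ (0.-tuple mR) [tuple] R).
rewrite /= -muE; set nu := pushforward _ _.
have m0 : nu set0 = 0 by rewrite /nu /pushforward preimage_set0 measure0.
have mge0 A : 0 <= nu A by exact: (measure_ge0 (lebesgue_measure \x mu)).
have msg : semi_sigma_additive nu.
  by apply: pushforward_semi_sigma_additive; exact: measurable_tuple_cons.
apply: bundle_sigma_finite_measure => //.
have [F TF Foo] : sigma_finite setT (@lebesgue_measure R \x mu).
  exact: product_sigma_finite.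
exists (fun k => (fun t : n.+1.-tuple mR => (thead t, [tuple of behead t])) @^-1` F k).
  by rewrite -preimage_bigcup -TF preimage_setT.
move=> k; have [mFk Fk] := Foo k; split.
  exact: (measurable_preimage (@measurable_tuple_uncons n) mFk).
rewrite /nu /pushforward (_ : _ @^-1` _ = F k)//; apply/funext => p.
by rewrite /preimage/= tuple_consK.
Qed.

Definition lebesgue_box n (L : R) : set (n.-tuple mR) :=
  [set t | forall i, (0 <= tnth t i < L)%R].

Arguments lebesgue_box : clear implicits.

Lemma measurable_lebesgue_box n L : measurable (lebesgue_box n L).
Proof.
rewrite (_ : lebesgue_box n L =
    \bigcap_(i : 'I_n) ((fun t : n.-tuple mR => tnth t i) @^-1` `[0%R, L[)).
  apply: fin_bigcap_measurable; first exact: finite_finset.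
  move=> i _; apply: (measurable_preimage (measurable_tnth i)).
  exact: measurable_itv.
by apply/seteqP; split=> [t H i _|t H i] /=;
  [rewrite in_itv/=; exact: H|have := H i I; rewrite /= in_itv].
Qed.

Lemma lebesgue_tuple_box n (L : R) : (0 < L)%R ->
  lebesgue_tuple n (lebesgue_box n L) = (L ^+ n)%:E.
Proof.
move=> L0; elim: n => [|n IHn].
  by rewrite /= diracE mem_set// => -[].
have [mu muE] := lebesgue_tuple_measure n.
rewrite /= /pushforward -muE.
rewrite (_ : _ @^-1` _ = `[0%R, L[ `*` lebesgue_box n L).
  rewrite product_measure1E//; last exact: measurable_lebesgue_box.
  rewrite muE IHn exprS EFinM; congr (_ * _)%E.
  by have := lebesgue_measure_itv `[0%R, L[; rewrite /= lte_fin L0 sube0.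
apply/seteqP; split => [[x t] H|[x t] [xL H]] /=.
  split; first by have := H ord0; rewrite /= in_itv.
  by move=> i; have := H (lift ord0 i); rewrite tnthS.
move=> i; have [j ->|->] := unliftP ord0 i; first by rewrite tnthS; exact: H.
by rewrite /= in_itv in xL.
Qed.

End lebesgue_tuple.
Arguments lebesgue_box {R} n L.

(** * The torus and its distance *)

Lemma row_coord_le (R : realType) n (v : 'rV[R]_n) i : `|v 0 i| <= `|v|.
Proof.
rewrite -[leRHS]/(mx_norm v) mx_normrE.
exact: (le_bigmax_cond 0 (fun ij : 'I_1 * 'I_n => `|v ij.1 ij.2|) (erefl : xpredT (ord0, i))).
Qed.

Lemma row_norm_le (R : realType) n (v : 'rV[R]_n) (M : R) : 0 <= M ->
  (forall i, `|v 0 i| <= M) -> `|v| <= M.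
Proof.
move=> M0 vM; rewrite -[leLHS]/(mx_norm v) mx_normrE.
by apply: bigmax_le => // -[i j] _ /=; rewrite ord1.
Qed.

Lemma rat_row_approx (R : realType) n (x : 'rV[R]_n) (e : R) : 0 < e ->
  exists q : 'rV[rat]_n, `|x - map_mx ratr q| < e.
Proof.
move=> e0; have e20 : 0 < e / 2 by rewrite divr_gt0.
have qex i : exists q : rat, `|x 0 i - ratr q| < e / 2.
  have [q] : exists q : rat, ratr q \in `]x 0 i - e / 2, x 0 i + e / 2[.
    by apply: rat_in_itvoo; rewrite ltrD2l (lt_trans _ e20)// oppr_lt0.
  by rewrite in_itv/= => tq; exists q; rewrite ltr_distlC.
exists (\row_i sval (cid (qex i))).
apply: (@le_lt_trans _ _ (e / 2)); last by rewrite ltr_pdivrMr// ltr_pMr// ltr1n.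
apply: row_norm_le; first exact: ltW.
by move=> i; rewrite !mxE; case: cid => q /= /ltW.
Qed.

Section torus.
Context (R : realType) (d : nat) (L : R).
Local Notation T := (torus d L).
Local Notation pi := (\pi_(torus d L) : 'rV[R]_d -> T).

Lemma torus_piB (x y : 'rV[R]_d) : pi (x - y) = pi x - pi y.
Proof. exact: (raddfB (\pi_(Quotient.quot (lattice d L)))). Qed.

Lemma torus_piN (x : 'rV[R]_d) : pi (- x) = - pi x.
Proof. exact: (raddfN (\pi_(Quotient.quot (lattice d L)))). Qed.

Lemma torus_piD (x y : 'rV[R]_d) : pi (x + y) = pi x + pi y.
Proof. exact: (raddfD (\pi_(Quotient.quot (lattice d L)))). Qed.

Lemma torus_pi_surj (p : T) : exists x, pi x = p.
Proof. by exists (repr p); exact: reprK. Qed.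

Lemma torus_pi_eq (x y : 'rV[R]_d) : x - y \in lattice d L -> pi x = pi y.
Proof. by move=> xy; have := Quotient.idealrBE (lattice d L) x y; rewrite xy => /esym/eqP. Qed.

Lemma torus_pi_continuous : continuous pi.
Proof. exact: pi_continuous. Qed.

Let dist_set (p q : T) := [set `|v| | v in [set v : 'rV[R]_d | pi v = p - q]].

Let dist_set_lb (p q : T) : lbound (dist_set p q) 0.
Proof. by move=> _ [v _ <-]. Qed.

Lemma torus_dist_ge0 (p q : T) : 0 <= torus_dist p q.
Proof.
have [v pv] := torus_pi_surj (p - q).
by apply: lb_le_inf (@dist_set_lb p q); exists `|v|; exists v.
Qed.

Lemma torus_dist_le (p q : T) v : pi v = p - q -> torus_dist p q <= `|v|.
Proof. by move=> pv; apply: ge_inf; [exists 0; exact: dist_set_lb|exists v]. Qed.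

Lemma le_torus_dist (p q : T) (C : R) :
  (forall v, pi v = p - q -> C <= `|v|) -> C <= torus_dist p q.
Proof.
move=> H; have [v pv] := torus_pi_surj (p - q).
by apply: lb_le_inf; [exists `|v|; exists v|move=> _ [w pw <-]; exact: H].
Qed.

Lemma torus_distC (p q : T) : torus_dist p q = torus_dist q p.
Proof.
suff H (u w : T) : torus_dist u w <= torus_dist w u by apply/eqP; rewrite eq_le !H.
apply: le_torus_dist => v pv; rewrite -normrN; apply: torus_dist_le.
by rewrite torus_piN pv opprB.
Qed.

Lemma torus_dist_subr (p q r : T) : torus_dist (p - r) (q - r) = torus_dist p q.
Proof. by rewrite /torus_dist opprB addrA subrK. Qed.

Lemma torus_dist_pi (x y : 'rV[R]_d) : torus_dist (pi x) (pi y) <= `|x - y|.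
Proof. by apply: torus_dist_le; rewrite torus_piB. Qed.

Lemma torus_dist_triangle (p q r : T) :
  torus_dist p r <= torus_dist p q + torus_dist q r.
Proof.
rewrite -lerBlDl; apply: le_torus_dist => w pw.
rewrite lerBlDl -lerBlDr; apply: le_torus_dist => v pv.
rewrite lerBlDr (le_trans _ (ler_normD _ _))//; apply: torus_dist_le.
by rewrite torus_piD pv pw addrA subrK.
Qed.

Lemma torus_distxx (p : T) : torus_dist p p = 0.
Proof.
apply/eqP; rewrite eq_le torus_dist_ge0 andbT -[leRHS](@normr0 _ 'rV[R]_d).
by apply: torus_dist_le; rewrite subrr -[X in pi X](subrr 0) torus_piB subrr.
Qed.

(** By the quotient topology it is enough to look at lifts, where the distance is
    [1]-Lipschitz by the triangle inequality. *)
Lemma torus_dist_continuous (p : T) : continuous (fun q => torus_dist p q).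
Proof.
have cpi : continuous (fun x : 'rV[R]_d => torus_dist p (pi x)).
  move=> x; apply/(@cvgrPdist_lt _ _ _ _ (nbhs_filter x)) => r r0.
  have := nbhsx_ballx x r r0; apply: filterS => y; rewrite -ball_normE /=.
  apply: le_lt_trans.
  have h1 := torus_dist_triangle p (pi x) (pi y).
  have h2 := torus_dist_triangle p (pi y) (pi x).
  have h3 := torus_dist_pi x y.
  rewrite ler_norml; apply/andP; split; last first.
    by rewrite lerBlDl (le_trans h2)// lerD2l torus_distC.
  by rewrite lerBrDl lerBlDr (le_trans h1)// lerD2l.
by apply/quotient_continuous; exact: cpi.
Qed.

Lemma torus_dist_nbhs (p : T) (e : R) : 0 < e -> \forall q \near p, torus_dist p q < e.
Proof.
move=> e0; have /cvgrPdist_lt /(_ e e0) := @torus_dist_continuous p p.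
apply: filterS => q; rewrite torus_distxx sub0r normrN ger0_norm//.
exact: torus_dist_ge0.
Qed.

Hypothesis L_gt0 : 0 < L.

(** Subtract from each coordinate its integral number of periods. *)
Lemma torus_fundamental (p : T) : exists2 v, pi v = p & forall i, 0 <= v 0 i < L.
Proof.
have [x <-] := torus_pi_surj p.
exists (\row_i (x 0 i - L * (Num.floor (x 0 i / L))%:~R)).
  apply: torus_pi_eq; apply/forallP => i; rewrite !mxE addrAC subrr sub0r.
  by rewrite mulNr mulrAC divff ?gt_eqF// mul1r rpredN intr_int.
move=> i; rewrite mxE; set r := x 0 i / L.
have -> : x 0 i - L * (Num.floor r)%:~R = (r - (Num.floor r)%:~R) * L.
  by rewrite mulrBl divfK ?gt_eqF// (mulrC L).
have /andP[fr rf] := real_floor_itv (num_real r).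
rewrite mulr_ge0 ?subr_ge0 ?(ltW L_gt0)//= gtr_pMl// ltrBlDl.
by move: rf; rewrite intrD.
Qed.

Lemma torus_dist_le_side (p q : T) : torus_dist p q <= L.
Proof.
have [v pv vL] := torus_fundamental (p - q).
apply: le_trans (torus_dist_le pv) _.
apply: row_norm_le; first exact: ltW.
by move=> i; have /andP[v0 vl] := vL i; rewrite ger0_norm// ltW.
Qed.

Lemma fundamental_compact :
  compact [set v : 'rV[R]_d | forall i, v 0 i \in `[0, L]].
Proof. by apply: (@rV_compact _ _ (fun=> `[0, L]%classic)) => _; exact: segment_compact. Qed.

Lemma torus_compact : compact [set: T].
Proof.
rewrite (_ : setT = pi @` [set v : 'rV[R]_d | forall i, v 0 i \in `[0, L]]).
  apply: continuous_compact fundamental_compact.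
  by apply: continuous_subspaceT => x; exact: torus_pi_continuous.
apply/seteqP; split=> // p _; have [v pv vL] := torus_fundamental p.
exists v => // i; have /andP[v0 vl] := vL i.
by rewrite /= in_itv/= v0 ltW.
Qed.

End torus.

(** * The volume of the torus *)

Section volume.
Context (R : realType) (d : nat).
Local Notation mR := (measurableTypeR R).

(** An open set is the union of the countably many cubes with rational centre and
    radius [1 / (k + 1)] that it contains, and a cube is a finite intersection of
    coordinate conditions. *)
Lemma measurable_open_row n (U : set 'rV[R]_n) : open U ->
  measurable [set t : n.-tuple mR | U (\row_i tnth t i)].
Proof.
move=> oU.
pose q2r (q : 'rV[rat]_n) : 'rV[R]_n := map_mx ratr q.
pose box (q : 'rV[rat]_n) (k : nat) : set (n.-tuple mR) :=
  \bigcap_(i : 'I_n) ((fun t : n.-tuple mR => tnth t i) @^-1`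
     (ball (q2r q 0 i : R) k.+1%:R^-1)).
pose F (qk : 'rV[rat]_n * nat) :=
  if `[< ball (q2r qk.1) qk.2.+1%:R^-1 `<=` U >] then box qk.1 qk.2 else set0.
rewrite (_ : [set t | _] = \bigcup_qk F qk).
  apply: countable_bigcupT_measurable; first exact: countableP.
  move=> [q k]; rewrite /F; case: asboolP => // _.
  apply: fin_bigcap_measurable; first exact: finite_finset.
  move=> i _; apply: (measurable_preimage (measurable_tnth i)).
  by apply: open_measurable; exact: ball_open.
apply/seteqP; split=> [t /= Ut|t [[q k] _]]; last first.
  rewrite /F; case: asboolP => //= qU tq; apply: qU.
  by split=> [|i j]; [rewrite invr_gt0|rewrite ord1 [X in ball _ _ X]mxE; exact: tq].
move: oU; rewrite openE => /(_ _ Ut) /nbhs_ballP[e /= e0 eU].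
(* half of [e]: the cube contains the point and must stay inside its [e]-ball *)
have [k ke] : exists k : nat, k.+1%:R^-1 < e / 2.
  have e20 : 0 < e / 2 by rewrite divr_gt0.
  exists (Num.trunc (e / 2)^-1); rewrite invf_plt ?posrE//.
  exact: truncnS_gt.
have k0 : 0 < k.+1%:R^-1 :> R by rewrite invr_gt0.
have [q qP] := rat_row_approx (\row_i tnth t i) k0.
exists (q, k) => //; rewrite /F asboolT/=.
  move=> i _ /=; rewrite -ball_normE /= distrC.
  by apply: le_lt_trans qP; have := row_coord_le (\row_i tnth t i - q2r q) i; rewrite !mxE.
move=> y qy; apply: eU; move: qy; rewrite -!ball_normE /= => qy.
by rewrite (le_lt_trans (ler_distD (q2r q) _ _))// [ltRHS]splitr ltrD ?(lt_trans _ ke).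
Qed.

Variable L : R.
Local Notation T := (torus d L).

Lemma open_torus_measurable (U : set T) : open U -> measurable U.
Proof. by move=> oU; apply: sub_sigma_algebra. Qed.

Lemma continuous_torus_measurable (f : T -> R) :
  continuous f -> measurable_fun setT f.
Proof.
move=> /continuousP cf; apply: (measurability _ (RGenOpens.measurableE R)).
move=> _ [_ [a [b ->] <-]]; rewrite setTI; apply: open_torus_measurable.
by apply: cf; exact: interval_open.
Qed.

(** The volume is the image under this map of the Lebesgue measure on the box. *)
Definition torus_chart (t : d.-tuple mR) : T := \pi_(torus d L) (\row_i tnth t i).

Lemma measurable_torus_chart : measurable_fun setT torus_chart.
Proof.
apply: (measurability (@open T) erefl) => _ [U oU <-]; rewrite setTI.
apply: (@measurable_open_row _ (\pi_(torus d L) @^-1` U)).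
by move/continuousP : (@torus_pi_continuous R d L); exact.
Qed.

Let volumeE : exists mu : {measure set (d.-tuple mR) -> \bar R},
  mu = @lebesgue_tuple R d :> (set _ -> _) /\
  volume d L = pushforward (mrestr mu (@measurable_lebesgue_box R d L)) torus_chart.
Proof.
have [mu muE] := lebesgue_tuple_measure R d; exists mu; split=> //.
by apply/funext => A; rewrite /volume /pushforward /mrestr -muE setIC.
Qed.

Let volume0 : volume d L set0 = 0%E.
Proof. by have [mu [_ ->]] := volumeE; rewrite /pushforward preimage_set0 measure0. Qed.

Let volume_ge0 A : (0 <= volume d L A)%E.
Proof.
have [mu [muE _]] := volumeE; rewrite /volume -muE; exact: measure_ge0.
Qed.

Let volume_sigma_additive : semi_sigma_additive (volume d L).
Proof.
have [mu [_ ->]] := volumeE.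
exact: pushforward_semi_sigma_additive measurable_torus_chart.
Qed.

HB.instance Definition _ := isMeasure.Build _ _ _ (volume d L)
  volume0 volume_ge0 volume_sigma_additive.

Lemma volume_box : volume d L [set: T] = lebesgue_tuple d (lebesgue_box d L).
Proof.
by rewrite /volume; congr lebesgue_tuple; apply/seteqP; split=> [t []|t tL] //; split.
Qed.

Lemma volume_setT : 0 < L -> volume d L [set: T] = (L ^+ d)%:E.
Proof. by move=> L0; rewrite volume_box lebesgue_tuple_box. Qed.

Let volume_fin : fin_num_fun (volume d L).
Proof.
suff : (volume d L [set: T] < +oo)%E by exact: lty_fin_num_fun.
have [L0|L0] := ltP 0 L; first by rewrite volume_setT ?ltry.
rewrite volume_box; case: d => [|n]; first by rewrite /= diracE ltry.
rewrite (_ : lebesgue_box n.+1 L = set0).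
  by have [mu <-] := lebesgue_tuple_measure R n.+1; rewrite measure0 ltry.
apply/seteqP; split=> // t /(_ ord0) /andP[t0 tL].
by have := le_lt_trans t0 (lt_le_trans tL L0); rewrite ltxx.
Qed.

HB.instance Definition _ := Measure_isFinite.Build _ _ _ (volume d L) volume_fin.

End volume.

(** * The interaction kernel *)

Section kernel.
Context (R : realType) (d : nat) (L : R).
Hypothesis L_gt0 : 0 < L.
Local Notation T := (torus d L).
Local Notation pi := (\pi_(torus d L) : 'rV[R]_d -> T).

Lemma coordinate_mean_value (f : 'rV[R]_d -> R) (i : 'I_d) (M : R) :
  (forall x, derivable f x (delta_mx 0 i)) ->
  (forall x, `|'D_(delta_mx 0 i) f x| <= M) ->
  forall x t, `|f (x + t *: delta_mx 0 i) - f x| <= M * `|t|.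
Proof.
move=> df dM; set e := delta_mx 0 i.
pose g x (s : R) := f (x + s *: e).
have gE x s : (fun h : R => h^-1 *: ((g x \o shift s) (h *: 1) - g x s)) =
    (fun h => h^-1 *: ((f \o shift (x + s *: e)) (h *: e) - f (x + s *: e))).
  apply/funext => h; rewrite /g /=; congr (_ *: (f _ - _)).
  by rewrite [h *: 1]mulr1 scalerDl addrCA.
have gd x s : is_derive s (1 : R) (g x) ('D_e f (x + s *: e)).
  apply: DeriveDef; first by rewrite /derivable gE; exact: df.
  by rewrite /derive gE.
suff H x t : 0 <= t -> `|f (x + t *: e) - f x| <= M * t.
  move=> x t; have [t0|t0] := leP 0 t; first by rewrite (ger0_norm t0) H.
  have := H (x + t *: e) (- t); rewrite oppr_ge0 ltW// => /(_ isT).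
  by rewrite scaleNr addrK distrC (ltr0_norm t0).
move=> t0.
have [|c _] := MVT_segment t0 (fun s _ => gd x s).
  by apply: derivable_within_continuous => s _; exact: (@ex_derive _ _ _ _ _ _ _ (gd x s)).
rewrite /g scale0r addr0 subr0 => ->.
by rewrite normrM (ger0_norm t0) ler_wpM2r.
Qed.

(** Replace the coordinates of [y] by those of [x] one at a time; each replacement
    moves the point parallel to an axis. *)
Lemma lipschitz_of_bounded_partials (f : 'rV[R]_d -> R) (M : 'I_d -> R) :
  (forall i x, derivable f x (delta_mx 0 i)) ->
  (forall i x, `|'D_(delta_mx 0 i) f x| <= M i) ->
  forall x y, `|f x - f y| <= (\sum_i M i) * `|x - y|.
Proof.
move=> df dM x y.
have M0 i : 0 <= M i by apply: le_trans (dM i 0).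
pose mix (s : seq 'I_d) : 'rV[R]_d := \row_j (if j \in s then x 0 j else y 0 j).
have mixS i s : i \notin s ->
    mix (i :: s) = mix s + (x 0 i - y 0 i) *: delta_mx 0 i.
  move=> ins; apply/rowP => j; rewrite !mxE in_cons eqxx/=.
  have [->|ji] /= := eqVneq j i; last by rewrite mulr0 addr0.
  by rewrite (negPf ins) mulr1 subrKC.
have step s : uniq s -> `|f (mix s) - f y| <= (\sum_(i <- s) M i) * `|x - y|.
  elim: s => [_|i s IH /= /andP[ins us]].
    rewrite big_nil mul0r (_ : mix [::] = y) ?subrr ?normr0//.
    by apply/rowP => j; rewrite mxE.
  rewrite big_cons mulrDl (le_trans (ler_distD (f (mix s)) _ _))// lerD ?IH//.
  rewrite mixS//; apply: le_trans (coordinate_mean_value (df i) (dM i) _ _) _.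
  by rewrite ler_wpM2l//; have := row_coord_le (x - y) i; rewrite !mxE.
have := step (index_enum 'I_d) (index_enum_uniq _).
by rewrite (_ : mix _ = x)//; apply/rowP => j; rewrite mxE mem_index_enum.
Qed.

(** The partial derivatives of the lift are periodic and continuous, hence bounded
    by their bounds on the compact fundamental cube.  The Lipschitz bound for
    lifts holds for every lift of [p - q], so it passes to the infimum that
    defines the distance. *)
Lemma torus_C1_lipschitz (W : T -> R) : torus_Ck 1 W ->
  exists2 K : R, 0 <= K & forall p q, `|W p - W q| <= K * torus_dist p q.
Proof.
pose f x := W (pi x); move=> [cf dfc].
have fper v x : v \in lattice d L -> f (x + v) = f x.
  by move=> vL; rewrite /f (@torus_pi_eq _ _ _ (x + v) x)// addrAC subrr add0r.
have Dper i v x : v \in lattice d L -> 'D_(delta_mx 0 i) f (x + v) = 'D_(delta_mx 0 i) f x.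
  move=> vL; rewrite /derive; set e := delta_mx 0 i.
  rewrite (_ : (fun h : R => _) = fun h => h^-1 *: ((f \o shift x) (h *: e) - f x))//.
  by apply/funext => h /=; rewrite addrA !(fper _ _ vL).
have bnd i : exists M, forall x, `|'D_(delta_mx 0 i) f x| <= M.
  have [_ [cD _]] := dfc i.
  have := continuous_compact (continuous_subspaceT cD) (@fundamental_compact R d L).
  move=> /compact_bounded [M [_ HM]]; exists (M + 1) => x.
  have [v pv vL] := torus_fundamental L_gt0 (pi x).
  have xv : x - v \in lattice d L.
    by rewrite (Quotient.idealrBE (lattice d L)); apply/eqP; exact: (esym pv).
  rewrite -(subrKC v x) Dper//; apply: HM; first by rewrite ltrDl.
  by exists v => // i' ; rewrite /= in_itv/=; have /andP[-> /ltW] := vL i'.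
have M0 i : 0 <= sval (cid (bnd i)).
  by apply: le_trans (svalP (cid (bnd i)) 0).
exists (\sum_i sval (cid (bnd i))); first exact: sumr_ge0.
move=> p q; set K := \sum_i _.
have [y <-] := torus_pi_surj q.
have H v : pi v = p - pi y -> `|W p - W (pi y)| <= K * `|v|.
  move=> pv; have -> : p = pi (v + y) by rewrite torus_piD pv subrK.
  rewrite -[X in _ * `|X|](addrK y v).
  apply: (lipschitz_of_bounded_partials _ (fun i => svalP (cid (bnd i)))).
  by move=> i; have [+ _] := dfc i.
have K0 : 0 <= K by exact: sumr_ge0.
have [K00|Kn0] := eqVneq K 0.
  by have [v /H] := torus_pi_surj (p - pi y); rewrite K00 !mul0r.
have {}K0 : 0 < K by rewrite lt_neqAle eq_sym Kn0.
rewrite -ler_pdivrMl//; apply: le_torus_dist => v /H.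
by rewrite -ler_pdivrMl.
Qed.

(** The point reflection is the composition of all coordinate reflections. *)
Lemma coord_even_opp (W : T -> R) : coord_even W -> forall p, W (- p) = W p.
Proof.
move=> We p; have [x <-] := torus_pi_surj p; rewrite -torus_piN.
pose flip (s : seq 'I_d) : 'rV[R]_d := \row_j (if j \in s then - x 0 j else x 0 j).
have H s : uniq s -> W (pi (flip s)) = W (pi x).
  elim: s => [_|i s IH /= /andP[ins us]].
    by congr (W (pi _)); apply/rowP => j; rewrite mxE.
  rewrite -IH// -(We i (flip s)); congr (W (pi _)); apply/rowP => j; rewrite !mxE in_cons.
  by have [->|] := eqVneq j i => //=; rewrite (negPf ins).
rewrite -(H (index_enum 'I_d)) ?index_enum_uniq//; congr (W (pi _)).
by apply/rowP => j; rewrite !mxE mem_index_enum.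
Qed.

Section lipschitz_kernel.
Variables (W : T -> R) (K : R).
Hypotheses (K_ge0 : 0 <= K) (W_lip : forall p q, `|W p - W q| <= K * torus_dist p q).

Lemma lipschitz_bounded p : `|W p| <= `|W 0| + K * L.
Proof.
rewrite -[W p](subrK (W 0)) addrC (le_trans (ler_normD _ _))// lerD2l.
by rewrite (le_trans (W_lip _ _))// ler_wpM2l// torus_dist_le_side.
Qed.

(** Continuity only gives measurability for the Borel sets of the product, so the
    preimage of an interval is written as a countable union of measurable
    rectangles: balls around points with rational coordinates in the first
    variable, times sets where [W (c - y)] lies in the interval shrunk by [K * r],
    the error made when the first variable moves by at most [r]. *)
Lemma measurable_translation_kernel :
  measurable_fun setT (fun z : T * T => W (z.1 - z.2)).
Proof.
apply: (measurability _ (RGenOpens.measurableE R)) => _ [_ [a [b ->] <-]].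
rewrite setTI.
pose c (q : 'rV[rat]_d) : T := pi (map_mx ratr q).
pose r (n : nat) : R := n.+1%:R^-1.
pose F (qn : 'rV[rat]_d * nat) : set (T * T) :=
  [set p | torus_dist (c qn.1) p < r qn.2] `*`
  [set y | a + K * r qn.2 < W (c qn.1 - y) < b - K * r qn.2].
rewrite (_ : _ @^-1` _ = \bigcup_qn F qn).
  apply: countable_bigcupT_measurable; first exact: countableP.
  move=> [q n]; apply: measurableX.
    have := continuous_torus_measurable (@torus_dist_continuous _ _ _ (c q)).
    move=> /measurable_preimage /(_ _ (measurable_itv `]-oo, r n[)).
    by rewrite (_ : _ @^-1` _ = [set p | torus_dist (c q) p < r n])//;
      apply/funext => p; rewrite /preimage/= in_itv.
  have cW : continuous (fun y : T => W (c q - y)).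
    move=> y; apply/(@cvgrPdist_lt _ _ _ _ (nbhs_filter y)) => e e0.
    have K1 : 0 < K + 1 by rewrite ltr_wpDl.
    have := torus_dist_nbhs y (divr_gt0 e0 K1); apply: filterS => w.
    rewrite ltr_pdivlMr// mulrC => yw; apply: le_lt_trans (W_lip _ _) (le_lt_trans _ yw).
    rewrite (_ : torus_dist _ _ = torus_dist y w).
      by rewrite ler_wpM2r ?torus_dist_ge0// lerDl.
    by rewrite torus_distC /torus_dist opprB addrC addrA subrK.
  have := continuous_torus_measurable cW.
  move=> /measurable_preimage /(_ _ (measurable_itv `]a + K * r n, b - K * r n[)).
  by rewrite (_ : _ @^-1` _ = [set y | a + K * r n < W (c q - y) < b - K * r n])//;
    apply/funext => p; rewrite /preimage/= in_itv.
have dist_kernel p q y : `|W (p - y) - W (q - y)| <= K * torus_dist q p.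
  by rewrite torus_distC -(torus_dist_subr p q y).
apply/seteqP; split=> [[p y]|[p y] [[q n] _ [/= pq]]]; last first.
  rewrite /= in_itv/= => /andP[h1 h2].
  have := le_trans (dist_kernel p (c q) y) (ler_wpM2l K_ge0 (ltW pq)).
  by rewrite ler_norml => /andP[h3 h4]; apply/andP; split; lra.
rewrite /= in_itv/= => /andP[aw wb]; set w := W (p - y).
pose e := Num.min (w - a) (b - w) / (2 * K + 1).
have K1 : 0 < 2 * K + 1 by rewrite ltr_wpDl// mulr_ge0.
have e0 : 0 < e by rewrite divr_gt0// lt_min !subr_gt0 aw.
have [n ne] : exists n : nat, r n < e.
  exists (Num.trunc e^-1); rewrite invf_plt ?posrE//; exact: truncnS_gt.
have r0 : 0 < r n by rewrite invr_gt0.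
have [x xp] := torus_pi_surj p.
have [q xq] := rat_row_approx x r0.
have dq : torus_dist (c q) p < r n.
  by rewrite torus_distC -xp (le_lt_trans (torus_dist_pi _ _ _))//.
exists (q, n) => //; split=> //=.
have := le_trans (dist_kernel p (c q) y) (ler_wpM2l K_ge0 (ltW dq)).
rewrite -/w ler_norml => /andP[h3 h4].
have : (2 * K + 1) * r n < Num.min (w - a) (b - w).
  by rewrite mulrC -ltr_pdivlMr.
rewrite lt_min mulrDl mul1r => /andP[h5 h6].
by apply/andP; split; lra.
Qed.

End lipschitz_kernel.
End kernel.

(** * Compactness of Holder balls *)

Section holder_compact.
Context (R : realType) (d : nat) (L : R).
Hypothesis L_gt0 : 0 < L.
Local Notation T := (torus d L).
Variables (a C M : R).
Hypotheses (a_gt0 : 0 < a) (C_ge0 : 0 <= C).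

Definition bounded_holder : set (T -> R) := [set f | (forall x, 0 <= f x <= M) /\
  (forall p q, `|f p - f q| <= C * torus_dist p q `^ a)].

Lemma holder_equicontinuous : equicontinuous bounded_holder id.
Proof.
move=> x E; rewrite -entourage_ballE => -[e /= e0 eE].
have e20 : 0 < e / 2 by rewrite divr_gt0.
have [dl dl0 Hdl] := powR_small a_gt0 C_ge0 e20.
have := torus_dist_nbhs x dl0; apply: filterS => y xy f [_ fH]; apply: eE.
rewrite /= -ball_normE /=; apply: le_lt_trans (fH _ _) (le_lt_trans (Hdl _ _) _).
  by rewrite torus_dist_ge0 ltW.
by rewrite ltr_pdivrMr// ltr_pMr// ltr1n.
Qed.

Lemma holder_continuous (f : T -> R) : bounded_holder f -> continuous f.
Proof. exact: equicontinuous_continuous holder_equicontinuous. Qed.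

(** The Arzela-Ascoli theorem in the topology of compact convergence. *)
Lemma bounded_holder_precompact :
  precompact (bounded_holder : set {family compact, T -> R}).
Proof.
apply: pointwise_precompact_equicontinuous holder_equicontinuous.
  exact: Rhausdorff.
move=> x; apply: (@precompact_subset _ _ `[0, M]%classic).
  by move=> _ [f [fM _] <-]; rewrite /= in_itv/=; exact: fM.
by rewrite precompact_closed; [exact: segment_compact|exact: interval_closed].
Qed.

Lemma uniform_near (h : {uniform T -> R}) (e : R) : 0 < e ->
  \forall g \near h, forall x, `|h x - g x| < e.
Proof.
move=> e0; apply/uniform_nbhs; exists [set xy | `|xy.1 - xy.2| < e]; split.
  rewrite -entourage_ballE; exists e => // -[x y] /=; by rewrite -ball_normE.
by move=> g hg x; exact: hg.
Qed.

(** The defining inequalities are pointwise and not strict, so they survive limits. *)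
Lemma bounded_holder_uniform_limit (F : set_system {uniform T -> R})
    (h : {uniform T -> R}) : ProperFilter F ->
  F --> h -> F bounded_holder -> bounded_holder h.
Proof.
move=> PF Fh FE.
have approx (e : R) : 0 < e -> exists2 g, bounded_holder g & forall x, `|h x - g x| < e.
  move=> e0.
  have H : F (bounded_holder `&` [set g : T -> R | forall x, `|h x - g x| < e]).
    by apply: filterI => //; exact: Fh (uniform_near h e0).
  by have [g [gE hg]] := filter_ex H; exists g.
split=> [x|p q].
  apply/andP; split; apply/ler_addgt0Pr => e e0; have [g [gM _] hg] := approx e e0;
    have := gM x; have := hg x; rewrite ltr_norml => /andP[? ?] /andP[? ?]; lra.
apply/ler_addgt0Pr => e e0; have [//|g [_ gH] hg] := approx (e / 2).
  by rewrite divr_gt0.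
move: (hg p) (hg q) (gH p q); set K := C * _.
rewrite !ler_norml !ltr_norml => /andP[? ?] /andP[? ?] /andP[? ?].
by apply/andP; split; lra.
Qed.

(** On the compact torus compact convergence is uniform convergence, which carries
    the cluster points given by [bounded_holder_precompact] over; they stay in the
    set by [bounded_holder_uniform_limit], hence
    lie in C^0. *)
Lemma bounded_holder_C0_precompact :
  precompact [set f : C0 d L | bounded_holder (\val f)].
Proof.
set A := [set f : C0 d L | _].
have val_cvg (F : set_system (C0 d L)) (f : C0 d L) : F --> f ->
    ((set_val : C0 d L -> {uniform T -> R}) @ F) --> (set_val f : {uniform T -> R}).
  by move=> Ff; apply: cvg_trans (@initial_continuous _ _ _ f); exact: cvg_app.
rewrite precompact_closed; last first.
  rewrite closure_id; apply/seteqP; split; first exact: subset_closure.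
  rewrite closureEcvg => f [F PF [Ff FA]].
  apply: (bounded_holder_uniform_limit _ (val_cvg _ _ Ff)).
  exact: FA.
move=> F PF FA.
pose G : set_system {family compact, T -> R} := (set_val : C0 d L -> {uniform T -> R}) @ F.
have PG : ProperFilter G by exact: fmap_proper_filter.
have := bounded_holder_precompact; rewrite precompactE => /(_ G PG).
case; first by apply: filterS FA; exact: subset_closure.
move=> h [hE Gh].
have family_uniform (H : set_system {family compact, T -> R}) : Filter H ->
    {family compact, H --> h} -> {uniform, H --> h}.
  by move=> FH /fam_cvgP; apply; exact: torus_compact.
have {}hE : bounded_holder h.
  move: hE; rewrite closureEcvg => -[H PH [Hh HE]].
  apply: (@bounded_holder_uniform_limit H h PH); first exact: family_uniform.
  exact: HE.
have hC : (h : {uniform T -> R}) \in C0 d L by rewrite inE; exact: holder_continuous.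
exists (exist _ h hC); split => //= U V FU [_ [[B oB <-] Bh] BV].
have nB : nbhs (h : {uniform T -> R}) B by apply: open_nbhs_nbhs.
have [g [[f Uf <-] Bf]] := Gh (set_val @` U) B
  (filterS (@preimage_image _ _ set_val U) FU) (family_uniform _ _ (fun _ => id) _ nB).
by exists f; split => //; exact: BV.
Qed.

End holder_compact.

(** * Minimisers of the free energy *)

Section densities.
Context (R : realType) (d : nat) (L : R).
Local Notation T := (torus d L).
Local Notation mu := (volume d L).
Local Notation L1 f := (mu.-integrable setT (EFin \o f)).
Implicit Types (rho : probability T R) (f g : T -> R).

Lemma is_density_integrable rho f : is_density rho f ->
  L1 f /\ \int[mu]_x f x = 1.
Proof.
move=> [mf f0 rhoE]; have := rhoE _ measurableT; rewrite probability_setT => If.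
split; last by rewrite /Rintegral -If.
apply/integrableP; split; first exact/measurable_EFinP.
by under eq_integral do rewrite /= ger0_norm//; rewrite -If ltry.
Qed.

Lemma is_density_ae rho f g : is_density rho f -> is_density rho g ->
  {ae mu, forall x, f x = g x}.
Proof.
move=> fd gd; have [fi _] := is_density_integrable fd.
have [mf f0 fE] := fd; have [mg g0 gE] := gd.
have : ae_eq mu setT (EFin \o f) (EFin \o g).
  apply: integral_ae_eq => //; first exact/measurable_EFinP.
  by move=> A _ mA; rewrite -fE// -gE.
by apply: filterS => x /(_ I) [].
Qed.

Lemma is_density_eq_ae rho f g : is_density rho f -> measurable_fun setT g ->
  (forall x, 0 <= g x) -> {ae mu, forall x, f x = g x} -> is_density rho g.
Proof.
move=> [mf f0 fE] mg g0 fg; split=> // A mA; rewrite fE//.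
apply: ae_eq_integral => //.
- exact: measurable_funTS (measurableT_comp _ mf).
- exact: measurable_funTS (measurableT_comp _ mg).
- by apply: filterS fg => x -> _.
Qed.

Lemma probability_of_density f : L1 f -> (forall x, 0 <= f x) ->
  \int[mu]_x f x = 1 -> exists rho, is_density rho f.
Proof.
move=> fi f0 If; have mf := L1_measurable fi.
pose nu (A : set T) := (\int[mu]_(x in A) (f x)%:E)%E.
have nu0 : nu set0 = 0%E by rewrite /nu integral_set0.
have nu_ge0 A : (0 <= nu A)%E by apply: integral_ge0 => x _; rewrite lee_fin.
have nu_add : semi_sigma_additive nu.
  by apply: semi_sigma_additive_nng_induced => //; exact/measurable_EFinP.
have nu1 : nu setT = 1%E.
  by rewrite /nu -[LHS]fineK ?(integrable_fin_num measurableT fi)// -/(Rintegral _ _ _) If.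
pose nu' : {measure set T -> \bar R} :=
  HB.pack nu (isMeasure.Build _ _ _ nu nu0 nu_ge0 nu_add).
pose rho : probability T R :=
  HB.pack (Measure.sort nu') (Measure_isProbability.Build _ _ _ nu' nu1).
by exists rho; split.
Qed.

Lemma densityP rho f : is_density rho f -> is_density rho (density rho).
Proof. by move=> fd; rewrite /density; apply: xgetPex; exists f. Qed.

End densities.

Section torus_energy.
Context (R : realType) (d : nat) (L : R) (W : torus d L -> R) (m : R).
Hypotheses (L_gt0 : 0 < L) (W_C1 : torus_Ck 1 W) (W_even : coord_even W).
Hypothesis m_gt1 : 1 < m.
Local Notation T := (torus d L).
Local Notation mu := (volume d L).
Local Notation L1 f := (mu.-integrable setT (EFin \o f)).

Let k (x y : T) : R := W (x - y).
Let K := sval (cid2 (torus_C1_lipschitz L_gt0 W_C1)).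
Let K_ge0 : 0 <= K. Proof. exact: s2valP (cid2 (torus_C1_lipschitz L_gt0 W_C1)). Qed.
Let W_lip : forall p q, `|W p - W q| <= K * torus_dist p q.
Proof. exact: s2valP' (cid2 (torus_C1_lipschitz L_gt0 W_C1)). Qed.
Let B := `|W 0| + K * L.
Let kB x y : `|k x y| <= B. Proof. exact: (lipschitz_bounded L_gt0 K_ge0 W_lip). Qed.
Let mk : measurable_fun setT (fun z : T * T => k z.1 z.2).
Proof. exact: measurable_translation_kernel W_lip. Qed.
Let k_sym x y : k x y = k y x.
Proof. by rewrite /k -(coord_even_opp W_even) opprB. Qed.

(** The potential is an average of translates of [W], so it inherits the Lipschitz
    constant of [W]. *)
Lemma density_potential_lipschitz f : L1 f -> (forall x, 0 <= f x) ->
  \int[mu]_x f x = 1 ->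
  forall p q, `|potential mu k f p - potential mu k f q| <= K * torus_dist p q.
Proof.
move=> fi f0 If p q; rewrite /potential -RintegralB//; [|exact: (L1_kernel mk kB)..].
have di := L1_sub (L1_kernel mk kB p fi) (L1_kernel mk kB q fi).
apply: le_trans (le_normr_Rintegral _ di) _ => //.
rewrite -[leRHS]mulr1 -If -RintegralZl//; apply: le_Rintegral => //.
- exact: integrable_norm di.
- exact: L1_scale.
- move=> y _; rewrite -mulrBl normrM (ger0_norm (f0 y)) ler_wpM2r//.
  by rewrite -(torus_dist_subr p q y) /k.
Qed.

(** The density chosen in the definition of the free energy agrees with [f] almost
    everywhere, and every term depends only on this class. *)
Lemma free_energyE beta (rho : probability T R) f : is_density rho f ->
  admissible mu m f ->
  free_energy W m beta rho = (energy mu m beta k f - beta^-1 / (m - 1))%:E.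
Proof.
move=> fd [fi f0 If fm]; set g := density rho.
have gd : is_density rho g by exact: densityP fd.
have [gi Ig] := is_density_integrable gd.
have [mg g0 _] := gd.
have gf : {ae mu, forall x, f x = g x} by exact: is_density_ae fd gd.
have SE : (\int[mu]_x (g x `^ m)%:E)%E = (\int[mu]_x (f x `^ m))%:E.
  rewrite /Rintegral fineK; last exact: (integrable_fin_num measurableT fm).
  apply: ae_eq_integral => //.
  - by apply/measurable_EFinP; exact: (measurableT_comp (measurable_powR _)).
  - exact: measurable_int fm.
  - by apply: filterS gf => x -> _.
have JE : (\int[mu \x mu]_z (W (z.1 - z.2) * g z.1 * g z.2)%:E)%E =
    (\int[mu]_x (f x * potential mu k f x))%:E.
  rewrite (interactionE mk kB gi gi); congr EFin.
  have VE : potential mu k f =1 potential mu k g by exact: (potential_ae mk kB fi mg gf).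
  apply/esym/Rintegral_ae_eq; first exact: (L1_mul_potential mk kB fi fi).
    apply: measurable_funM => //; exact: (measurable_potential mk kB gi).
  by apply: filterS gf => x ->; rewrite VE.
rewrite /free_energy -/g SE JE asboolT; last by split.
by rewrite -!EFinM -EFinB -EFinD; congr EFin; rewrite /energy; ring.
Qed.

Lemma finite_energy_admissible beta (rho : probability T R) :
  (free_energy W m beta rho < +oo)%E ->
  is_density rho (density rho) /\ admissible mu m (density rho).
Proof.
rewrite /free_energy; case: asboolP => // -[fd S_fin _] _; split=> //.
have [fi If] := is_density_integrable fd; have [mf f0 _] := fd.
split=> //; apply/integrableP; split.
  by apply/measurable_EFinP; exact: (measurableT_comp (measurable_powR _)).
under eq_integral do rewrite /= ger0_norm ?powR_ge0//.
by move: S_fin; rewrite fin_numE => /andP[_]; rewrite ltey.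
Qed.

Let side_gt0 : 0 < L ^+ d. Proof. exact: exprn_gt0. Qed.

Let volume_mass : fine (mu setT) = L ^+ d.
Proof. exact: (congr1 fine (volume_setT d L_gt0)). Qed.

Lemma uniform_admissible : admissible mu m (cst (L ^+ d)^-1).
Proof.
apply: (@admissible_bounded _ _ _ _ _ m_gt1 _ (L ^+ d)^-1) => //.
  by move=> x; rewrite lexx andbT invr_ge0 ltW.
by rewrite Rintegral_cst// volume_mass mulVf// gt_eqF.
Qed.

(** Comparison with the uniform density shows that a minimiser has finite energy,
    hence a density; every admissible density is in turn a competitor, so the
    Euler-Lagrange equation applies. *)
Lemma minimiser_profile beta (rho : probability T R) : 0 < beta ->
  is_minimiser (free_energy W m beta) rho ->
  exists f c, [/\ L1 f, forall x, 0 <= f x, \int[mu]_x f x = 1,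
    \int[mu]_x profile m beta (potential mu k f) c x = 1 &
    is_density rho (profile m beta (potential mu k f) c)].
Proof.
move=> beta0 rho_min.
have fin : (free_energy W m beta rho < +oo)%E.
  have [ui u0 Iu _] := uniform_admissible.
  have [nu nud] := probability_of_density ui u0 Iu.
  by rewrite (le_lt_trans (rho_min nu))// (free_energyE _ nud uniform_admissible) ltry.
have [fd fa] := finite_energy_admissible fin; set f := density rho in fd fa.
have [fi f0 If fm] := fa.
have f_min g : admissible mu m g -> energy mu m beta k f <= energy mu m beta k g.
  move=> ga; have [gi g0 Ig _] := ga.
  have [nu nud] := probability_of_density gi g0 Ig.
  have := rho_min nu; rewrite (free_energyE _ nud ga) (free_energyE _ fd fa).
  by rewrite lee_fin lerD2r.
have M0 : 0 < fine (mu setT) by rewrite volume_mass.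
have [c fc Ic] := euler_lagrange m_gt1 beta0 mk kB k_sym M0 fa f_min.
exists f, c; split=> //; apply: (is_density_eq_ae fd _ _ fc).
- exact: (measurable_profile _ _ (measurable_potential mk kB fi)).
- by move=> x; exact: powR_ge0.
Qed.

(** The density of a minimiser is the power [1 / (m - 1)] of a Lipschitz function;
    the cap [1/2] keeps the exponent below [1] when [m <= 2]. *)
Definition holder_exponent : R := Num.min 2^-1 (m - 1)^-1.

Lemma holder_exponent_itv : 0 < holder_exponent < 1.
Proof.
rewrite lt_min invr_gt0 ltr0n/= invr_gt0 subr_gt0 m_gt1/=.
by rewrite gt_min invf_lt1 ?ltr1n.
Qed.

(** All constants depend on [beta] only through an upper bound [b], because the
    Lipschitz constant of [u^(m - 1)] grows linearly in [beta]. *)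
Lemma minimiser_regularity (b : R) : exists C M : R, 0 <= C /\
  forall beta, 0 < beta <= b -> forall rho : probability T R,
    is_minimiser (free_energy W m beta) rho ->
    exists2 u, is_density rho u & bounded_holder holder_exponent C M u.
Proof.
have /andP[a0 a1] := holder_exponent_itv; set a := holder_exponent in a0 a1 *.
have ap : a <= (m - 1)^-1 by rewrite ge_min lexx orbT.
have p0 : 0 < (m - 1)^-1 by rewrite invr_gt0 subr_gt0.
have mB0 : 0 < m - 1 by rewrite subr_gt0.
pose A := (2 / L ^+ d) `^ (m - 1).
pose S := Num.max 0 b * ((m - 1) / m).
have S0 : 0 <= S.
  by rewrite mulr_ge0 ?le_max ?lexx// divr_ge0 ?ltW// (lt_trans ltr01).
pose N := A + S * K * L.
have [C C0 HC] := powR_holder N a0 ap a1.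
exists (C * (S * K) `^ a), (N `^ (m - 1)^-1); split.
  by rewrite mulr_ge0 ?powR_ge0.
move=> beta /andP[beta0 betab] rho /(minimiser_profile beta0) [f [c [fi f0 If Iu ud]]].
set V := potential mu k f in Iu ud *; pose u := profile m beta V c.
exists u => //.
pose w x := stiffness m beta * Num.max 0 (c - V x).
have w0 x : 0 <= w x by exact: profile_arg_ge0.
have kS : stiffness m beta <= S.
  rewrite ler_wpM2r ?le_max ?betab ?orbT// divr_ge0 ?ltW// (lt_trans ltr01)//.
have w_lip p q : `|w p - w q| <= S * K * torus_dist p q.
  rewrite /w -mulrBr normrM (gtr0_norm (stiffness_gt0 m_gt1 beta0)) -mulrA.
  apply: ler_pM => //; first by rewrite ltW// stiffness_gt0.
  apply: le_trans (max0_lipschitz _ _) _.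
  rewrite (_ : c - V p - (c - V q) = V q - V p) 1?distrC; last by ring.
  exact: density_potential_lipschitz.
(* a density above [2 / L^d] everywhere would have mass at least [2] *)
have [x0 ux0] : exists x0, u x0 <= 2 / L ^+ d.
  apply: contrapT => /forallNP H.
  have Ic : \int[mu]_x (2 / L ^+ d) = 2.
    by rewrite Rintegral_cst// volume_mass divfK// gt_eqF.
  have [ui _] := is_density_integrable ud.
  have : \int[mu]_x (2 / L ^+ d) <= \int[mu]_x u x.
    apply: le_Rintegral => //; first exact: finite_measure_integrable_cst.
    by move=> x _; rewrite ltW// ltNge; apply/negP; exact: H.
  by rewrite Ic Iu lern1.
have wN x : 0 <= w x <= N.
  rewrite w0 /= -[w x](subrK (w x0)) addrC lerD//.
    rewrite -[w x0]/(stiffness m beta * _) -profile_powB1//.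
    apply: ge0_ler_powR; rewrite ?nnegrE ?powR_ge0 ?(ltW mB0)//.
    by rewrite divr_ge0// ltW.
  apply: le_trans (ler_norm _) (le_trans (w_lip _ _) _).
  by apply: ler_wpM2l; [exact: mulr_ge0|exact: torus_dist_le_side].
split=> [x|p q].
  have /andP[h1 h2] := wN x; rewrite profile_ge0 /=.
  by apply: ge0_ler_powR; rewrite ?nnegrE ?(ltW p0) ?(le_trans h1 h2).
apply: le_trans (HC _ _ (wN p) (wN q)) _.
rewrite -mulrA ler_wpM2l// -powRM ?(mulr_ge0 S0 K_ge0) ?torus_dist_ge0//.
apply: ge0_ler_powR; rewrite ?nnegrE ?normr_ge0 ?(ltW a0)//.
by rewrite (mulr_ge0 (mulr_ge0 S0 K_ge0)) ?torus_dist_ge0.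
Qed.

End torus_energy.

Lemma torus_CkW (R : realType) d (L : R) n (W : torus d L -> R) :
  torus_Ck n.+1 W -> torus_Ck n W.
Proof.
rewrite /torus_Ck; move: (fun x => _) => f; elim: n f => [|n IH] f [cf H] //; split=> // i.
by have [df Df] := H i; split=> //; exact: IH.
Qed.

Theorem lemma5p4 (R : realType) (d : nat) (L : R) (W : torus d L -> R) (m : R)
    (d_gt0 : (0 < d)%N) (L_gt0 : 0 < L)
    (W_C2 : torus_Ck 2%N W) (W_even : coord_even W)
    (W_mean : (\int[volume d L]_x (W x)%:E = 0)%E)
    (m_gt1 : 1 < m) :
  (exists a : R -> R,
    [/\ forall beta, 0 < beta -> 0 < a beta < 1,
        {in `]0, +oo[, continuous a} &
        forall beta, 0 < beta -> forall rho : probability (torus d L) R,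
          is_minimiser (free_energy W m beta) rho ->
          exists2 u, is_density rho u & holder (a beta) u]) /\
  (forall (I : set R) (rho : R -> probability (torus d L) R),
    is_interval I -> bounded_set I -> I `<=` `]0, +oo[ ->
    (forall beta, I beta -> is_minimiser (free_energy W m beta) (rho beta)) ->
    exists u : R -> C0 d L,
      (forall beta, I beta -> is_density (rho beta) (\val (u beta))) /\
      precompact (u @` I)).
Proof.
have W_C1 := torus_CkW W_C2.
have reg := minimiser_regularity L_gt0 W_C1 W_even m_gt1.
have /andP[a0 a1] := holder_exponent_itv m_gt1.
split.
  exists (cst (holder_exponent m)); split.
  - by move=> beta _; rewrite a0.
  - by move=> x _; exact: cst_continuous.
  - move=> beta beta0 rho rho_min; have [C [M [_ H]]] := reg beta.
    have [|u ud [_ uH]] := H beta _ rho rho_min; first by rewrite beta0 lexx.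
    by exists u => //; exists C.
move=> I rho _ [M0 [_ IM]] I0 rho_min.
have [C [M [C_ge0 H]]] := reg (M0 + 1).
have u_ex beta : exists u : C0 d L, I beta ->
    is_density (rho beta) (\val u) /\ bounded_holder (holder_exponent m) C M (\val u).
  have [Ib|nIb] := pselect (I beta); last first.
    have c0 : (cst 0 : {uniform torus d L -> R}) \in C0 d L.
      by rewrite inE; exact: cst_continuous.
    by exists (exist _ (cst 0) c0).
  have [|v vd vH] := H beta _ _ (rho_min beta Ib).
    have := I0 beta Ib; rewrite /= in_itv/= andbT => -> /=.
    by apply: le_trans (ler_norm _) (IM _ _ beta Ib); rewrite ltrDl.
  have vC : (v : {uniform torus d L -> R}) \in C0 d L.
    by rewrite inE; exact: (holder_continuous a0 C_ge0 vH).
  by exists (exist _ v vC).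
exists (fun beta => sval (cid (u_ex beta))); split.
  by move=> beta /(svalP (cid (u_ex beta))) [].
have := @bounded_holder_C0_precompact _ d _ L_gt0 _ _ M a0 C_ge0.
apply: precompact_subset.
by move=> _ [beta Ib <-]; have [] := svalP (cid (u_ex beta)) Ib.
Qed.
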